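(* Let $\mathcal{O}$ be a one-dimensional noetherian domain whose normalization $\tilde{\mathcal{O}}$ is finitely generated over $\mathcal{O}$. Let $\mathfrak{p}_1,\dots,\mathfrak{p}_r$ be the non-invertible maximal ideals of $\mathcal{O}$, for $1\le i\le r$ let $\mathfrak{P}_{i,1},\dots,\mathfrak{P}_{i,r_i}$ be the maximal ideals of $\tilde{\mathcal{O}}$ over $\mathfrak{p}_i$, let $d_{i,j}$ be the degree of $\tilde{\mathcal{O}}/\mathfrak{P}_{i,j}$ over $\mathcal{O}/\mathfrak{p}_i$, and let $g_i=\gcd(d_{i,1},\dots,d_{i,r_i})$. Let $\overline{f_*}\colon \mathrm{Chow}(\tilde{\mathcal{O}})\to\mathrm{Chow}(\mathcal{O})$ be the push-forward homomorphism. Then: (1) The local Chow group $\mathrm{Chow}(\mathcal{O}_\mathfrak{p})$ is trivial for every invertible maximal ideal $\mathfrak{p}$ of $\mathcal{O}$. (2) The local Chow group $\mathrm{Chow}(\mathcal{O}_{\mathfrak{p}_i})$ is isomorphic to $\mathbb{Z}/g_i\mathbb{Z}$ for all $1\le i\le r$. (3) The sequence $$0\to \mathrm{im}(\overline{f_*})\to \mathrm{Chow}(\mathcal{O})\to\bigoplus_{\mathfrak{p}\in\mathbb{P}(\mathcal{O})}\mathrm{Chow}(\mathcal{O}_\mathfrak{p})\to 0$$ is exact. Hence $\mathrm{Chow}(\mathcal{O})$ is an extension of $\mathrm{im}(\overline{f_*})\cong\mathrm{Chow}(\tilde{\mathcal{O}})/\ker(\overline{f_*})$ by the direct sum of the local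 Chow groups $\bigoplus_{i=1}^r\mathrm{Chow}(\mathcal{O}_{\mathfrak{p}_i})\cong\bigoplus_{i=1}^r\mathbb{Z}/g_i\mathbb{Z}$ (i.e. the former is the subgroup and the latter the quotient in the exact sequence of (3)).
   Context: Let $A$ be a one-dimensional noetherian domain with field of fractions $K$ whose normalization (integral closure in $K$) is finitely generated over $A$. $\mathbb{P}(A)$ is the set of maximal ideals of $A$. For $\mathfrak{p}\in\mathbb{P}(A)$, $A_\mathfrak{p}$ is the localization and $\mathrm{ord}_\mathfrak{p}\colon K^*\to\mathbb{Z}$ is the well-defined homomorphism $\frac{a}{b}\mapsto \mathrm{len}_{A_\mathfrak{p}}(A_\mathfrak{p}/aA_\mathfrak{p})-\mathrm{len}_{A_\mathfrak{p}}(A_\mathfrak{p}/bA_\mathfrak{p})$ (nonzero $a,b\in A$), where $\mathrm{len}$ is composition length. $\mathrm{Div}(A)$ is the free abelian group on $\mathbb{P}(A)$; $\mathcal{P}(A)$ is the image of $\mathrm{div}_A\colon K^*\to\mathrm{Div}(A)$, $a\mapsto\sum_{\mathfrak{p}}\mathrm{ord}_\mathfrak{p}(a)\mathfrak{p}$ (principal divisors); $\mathrm{Chow}(A)=\mathrm{Div}(A)/\mathcal{P}(A)$. These definitions are applied to $\mathcal{O}$, $\tilde{\mathcal{O}}$ and the localizations $\mathcal{O}_\mathfrak{p}$. A maximal ideal is called invertible if it is invertible as a fractional ideal; $\mathcal{O}$ has only finitely many non-invertible maximal ideals. For $\mathfrak{P}\in\mathbb{P}(\tilde{\mathcal{O}})$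 and $\mathfrak{p}=\mathfrak{P}\cap\mathcal{O}\in\mathbb{P}(\mathcal{O})$, let $\deg_\mathfrak{p}(\mathfrak{P})$ be the (finite) degree of the field $\tilde{\mathcal{O}}/\mathfrak{P}$ over $\mathcal{O}/\mathfrak{p}$. The push-forward $f_*\colon\mathrm{Div}(\tilde{\mathcal{O}})\to\mathrm{Div}(\mathcal{O})$ sends $\sum_\mathfrak{P}a_\mathfrak{P}\mathfrak{P}$ to $\sum_\mathfrak{P}a_\mathfrak{P}\deg_{\mathfrak{P}\cap\mathcal{O}}(\mathfrak{P})\,(\mathfrak{P}\cap\mathcal{O})$; it satisfies $f_*(\mathrm{div}_{\tilde{\mathcal{O}}}(a))=\mathrm{div}_{\mathcal{O}}(a)$ for $a\in K^*$, hence induces $\overline{f_*}\colon\mathrm{Chow}(\tilde{\mathcal{O}})\to\mathrm{Chow}(\mathcal{O})$. In the exact sequence the first map is the inclusion and the second is the canonical localization map $[\sum_\mathfrak{p}a_\mathfrak{p}\mathfrak{p}]\mapsto([a_\mathfrak{p}\,\mathfrak{p}\mathcal{O}_\mathfrak{p}])_\mathfrak{p}$. *)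

(* Defs.v *)
From HB Require Import structures.
From mathcomp Require Import all_boot all_order all_algebra.
From mathcomp Require Import all_classical.
From mathcomp.multinomials Require Import freeg.

Set Implicit Arguments.
Unset Strict Implicit.
Unset Printing Implicit Defensive.

Import GRing.Theory.
Local Open Scope classical_set_scope.
Local Open Scope quotient_scope.
Local Open Scope ring_scope.

(* Abelian groups are zmodTypes; their homomorphisms are {additive U -> V}. *)

Section QuotientGroup.
Variables (V : zmodType) (S : set V).

Definition generated : set V :=
  [set x | forall H : {pred V}, zmod_closed H -> S `<=` [set` H] -> x \in H].

Lemma generated0 : generated 0.
Proof. by move=> H [H0 _] _. Qed.

Lemma generatedB x y : generated x -> generated y -> generated (x - y).
Proof. by move=> gx gy H cH SH; apply: cH.2; [apply: gx | apply: gy]. Qed.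

Lemma generatedN x : generated x -> generated (- x).
Proof. by rewrite -sub0r; apply: generatedB; exact: generated0. Qed.

Lemma generatedD x y : generated x -> generated y -> generated (x + y).
Proof. by move=> gx /generatedN gy; rewrite -[y]opprK; exact: generatedB. Qed.

Definition quot_rel (x y : V) : bool := `[< generated (x - y) >].

Lemma quot_rel_refl : reflexive quot_rel.
Proof. by move=> x; apply/asboolP; rewrite subrr; exact: generated0. Qed.

Lemma quot_rel_sym : symmetric quot_rel.
Proof.
by move=> x y; apply/asboolP/asboolP => /generatedN; rewrite opprB.
Qed.

Lemma quot_rel_trans : transitive quot_rel.
Proof.
move=> y x z /asboolP gxy /asboolP gyz; apply/asboolP.
by rewrite -(subrKA y); apply: generatedD.
Qed.

Canonical quot_equiv :=
  EquivRel quot_rel quot_rel_refl quot_rel_sym quot_rel_trans.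
Canonical quot_equiv_direct := defaultEncModRel quot_rel.

(* V / <S>, where <S> is the subgroup generated by S; this is V / S as soon as S
   is a subgroup: see quot_class_eq0. *)
Definition quotient := {eq_quot quot_rel}.
HB.instance Definition _ := Choice.on quotient.
HB.instance Definition _ := EqQuotient.on quotient.

Lemma quot_piP x y : \pi_quotient x = \pi_quotient y <-> generated (x - y).
Proof. by split=> [/eqmodP/asboolP|/asboolP gxy] //; apply/eqmodP. Qed.

Lemma generated_repr x : generated (x - repr (\pi_quotient x)).
Proof. by apply/quot_piP; rewrite reprK. Qed.

Definition quot_zero : quotient := lift_cst quotient 0.
Definition quot_opp := lift_op1 quotient -%R.
Definition quot_add := lift_op2 quotient +%R.
Canonical pi_quot_zero := PiConst quot_zero.

Lemma pi_quot_opp : {morph \pi_quotient : x / - x >-> quot_opp x}.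
Proof.
move=> x; unlock quot_opp; apply/quot_piP; rewrite -opprD.
exact/generatedN/generated_repr.
Qed.
Canonical pi_quot_opp_morph := PiMorph1 pi_quot_opp.

Lemma pi_quot_add : {morph \pi_quotient : x y / x + y >-> quot_add x y}.
Proof.
move=> x y; unlock quot_add; apply/quot_piP.
by rewrite opprD addrACA; apply: generatedD; exact: generated_repr.
Qed.
Canonical pi_quot_add_morph := PiMorph2 pi_quot_add.

Lemma quot_addA : associative quot_add.
Proof.
by move=> x y z; rewrite -[x]reprK -[y]reprK -[z]reprK !piE addrA.
Qed.
Lemma quot_addC : commutative quot_add.
Proof. by move=> x y; rewrite -[x]reprK -[y]reprK !piE addrC. Qed.
Lemma quot_add0 : left_id quot_zero quot_add.
Proof. by move=> x; rewrite -[x]reprK !piE add0r. Qed.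
Lemma quot_addN : left_inverse quot_zero quot_opp quot_add.
Proof. by move=> x; rewrite -[x]reprK !piE addNr. Qed.

HB.instance Definition _ :=
  GRing.isZmodule.Build quotient quot_addA quot_addC quot_add0 quot_addN.

Definition quot_class (x : V) : quotient := \pi x.

Lemma quot_class_is_additive : {morph quot_class : x y / x - y}.
Proof. by move=> x y; rewrite /quot_class !piE. Qed.
HB.instance Definition _ :=
  GRing.isZmodMorphism.Build V quotient quot_class quot_class_is_additive.

Lemma quot_class_eq0 (H : zmod_closed (fun x => `[< S x >])) x :
  quot_class x = 0 <-> S x.
Proof.
have -> : (0 : quotient) = \pi 0 by rewrite piE.
split=> [/eqmodP/asboolP | Sx].
  rewrite subr0 => /(_ _ H) gx; apply/asboolP; apply: gx => y Sy.
  exact/asboolP.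
by apply/eqmodP/asboolP; rewrite subr0 => B _; apply.
Qed.

End QuotientGroup.

Section Image.
Variables (U V : zmodType) (f : {additive U -> V}).

Definition img_pred : {pred V} := fun y => `[< exists x, f x = y >].

Lemma img_zmod_closed : zmod_closed img_pred.
Proof.
split=> [|_ _ /asboolP[x <-] /asboolP[y <-]]; apply/asboolP.
  by exists 0; rewrite raddf0.
by exists (x - y); rewrite raddfB.
Qed.
HB.instance Definition _ :=
  GRing.isZmodClosed.Build V img_pred img_zmod_closed.

Record img := Img { img_val :> V; _ : img_val \in img_pred }.
HB.instance Definition _ := [isSub for img_val].
HB.instance Definition _ := [Choice of img by <:].
HB.instance Definition _ := [SubChoice_isSubZmodule of img by <:].

Definition img_incl : img -> V := val.
HB.instance Definition _ := GRing.Additive.on img_incl.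

End Image.
Arguments img_incl {U V} f _.

Definition ker (U V : zmodType) (f : {additive U -> V}) : set U :=
  [set x | f x = 0].

Definition isomorphic (U V : zmodType) : Prop :=
  exists f : {additive U -> V}, bijective f.

(* Exactness of 0 -> U -> V -> W -> 0. *)
Definition short_exact (U V W : zmodType)
    (f : {additive U -> V}) (g : {additive V -> W}) : Prop :=
  [/\ injective f, (forall y, g y = 0 <-> exists x, f x = y)
    & (forall z, exists y, g y = z)].

Definition Zmod (n : nat) : zmodType :=
  quotient [set k : int | exists m : int, k = m * n%:Z].

Section DirectSum.
Variables (I : Type) (V : I -> zmodType).

Record dsum := DSum {
  dsum_fun :> forall i, V i;
  dsum_finite : finite_set [set i | dsum_fun i <> 0] }.

Lemma dsum_ext (x y : dsum) : (forall i, x i = y i) -> x = y.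
Proof.
case: x y => [x xP] [y yP] /= exy.
have {}exy : x = y by exact: functional_extensionality_dep.
by subst y; congr DSum; exact: Prop_irrelevance.
Qed.

HB.instance Definition _ := gen_eqMixin dsum.
HB.instance Definition _ := gen_choiceMixin dsum.

Lemma dsum0_finite : finite_set [set i | (0 : V i) <> 0].
Proof. by apply: (sub_finite_set _ (finite_set0 I)) => i /=. Qed.
Definition dsum0 := DSum dsum0_finite.

Lemma dsumN_finite (x : dsum) : finite_set [set i | - x i <> 0].
Proof.
apply: (sub_finite_set _ (dsum_finite x)) => i /= xi0 eq0.
by apply: xi0; rewrite eq0 oppr0.
Qed.
Definition dsumN x := DSum (dsumN_finite x).

Lemma dsumD_finite (x y : dsum) : finite_set [set i | x i + y i <> 0].
Proof.
have fxy : finite_set ([set i | x i <> 0] `|` [set i | y i <> 0]).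
  by rewrite finite_setU; split; exact: dsum_finite.
apply: (sub_finite_set _ fxy) => i /= xy0.
by apply: contrapT => /not_orP[/contrapT x0 /contrapT y0]; rewrite x0 y0 addr0 in xy0.
Qed.
Definition dsumD x y := DSum (dsumD_finite x y).

Lemma dsumA : associative dsumD.
Proof. by move=> x y z; apply: dsum_ext => i /=; rewrite addrA. Qed.
Lemma dsumC : commutative dsumD.
Proof. by move=> x y; apply: dsum_ext => i /=; rewrite addrC. Qed.
Lemma dsum0D : left_id dsum0 dsumD.
Proof. by move=> x; apply: dsum_ext => i /=; rewrite add0r. Qed.
Lemma dsumND : left_inverse dsum0 dsumN dsumD.
Proof. by move=> x; apply: dsum_ext => i /=; rewrite addNr. Qed.

HB.instance Definition _ :=
  GRing.isZmodule.Build dsum dsumA dsumC dsum0D dsumND.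

End DirectSum.

(* The projection of a direct sum onto the summands of indices h 0, ..,
   h (r - 1). *)
Section Projection.
Variables (I : Type) (V : I -> zmodType) (r : nat) (h : 'I_r -> I).

Lemma dsum_proj_finite (x : dsum V) : finite_set [set j | x (h j) <> 0].
Proof. exact: finite_finset. Qed.

Definition dsum_proj (x : dsum V) : dsum (fun j => V (h j)) :=
  DSum (dsum_proj_finite x).

Lemma dsum_proj_is_additive : {morph dsum_proj : x y / x - y}.
Proof. by move=> x y; apply: dsum_ext. Qed.
HB.instance Definition _ :=
  GRing.isZmodMorphism.Build (dsum V) (dsum (fun j => V (h j)))
    dsum_proj dsum_proj_is_additive.
End Projection.

(* Throughout, rings are subrings A of a field K, given by their membership
   predicate, and A-modules are A-submodules of K. In particular A, its
   localizations and its normalization have the same field of fractions. *)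
Section Modules.
Variables (K : fieldType) (A : {pred K}).
Implicit Types (I J L M N : set K).

Definition submodule M : Prop :=
  M 0 /\ (forall a x y, a \in A -> M x -> M y -> M (a * x + y)).

Definition span n (e : 'I_n -> K) : set K :=
  [set x | exists2 c : 'I_n -> K,
     (forall i, c i \in A) & x = \sum_i c i * e i].

Definition finitely_generated M : Prop := exists n (e : 'I_n -> K), M = span e.

Definition ideal I : Prop := submodule I /\ I `<=` [set` A].

Definition prime_ideal I : Prop :=
  [/\ ideal I, ~ I 1 &
      forall x y, x \in A -> y \in A -> I (x * y) -> I x \/ I y].

Definition maximal_ideal I : Prop :=
  [/\ ideal I, ~ I 1 &
      forall J, ideal J -> ~ J 1 -> I `<=` J -> J = I].

Definition noetherian : Prop := forall I, ideal I -> finitely_generated I.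

Definition prime_chain n (p : nat -> set K) : Prop :=
  (forall i, (i <= n)%N -> prime_ideal (p i)) /\
  (forall i, (i < n)%N -> p i `<` p i.+1).

Definition krull_dim n : Prop :=
  (exists p, prime_chain n p) /\ ~ (exists p, prime_chain n.+1 p).

Definition fraction_field : Prop :=
  forall x, exists a b, [/\ a \in A, b \in A, b != 0 & x = a / b].

Definition fractional_ideal I : Prop :=
  [/\ submodule I, (exists2 x, I x & x != 0) &
      exists d, [/\ d \in A, d != 0 & forall x, I x -> d * x \in A]].

Definition ideal_mul I J : set K :=
  [set x | exists n (u v : 'I_n -> K),
     (forall i, I (u i) /\ J (v i)) /\ x = \sum_i u i * v i].

Definition invertible_ideal I : Prop :=
  fractional_ideal I /\
  exists J, fractional_ideal J /\ ideal_mul I J = [set` A].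

(* The submodules of M / N are the L / N for N `<=` L `<=` M, so this is a
   composition series of M / N, described by preimages in M. *)
Definition composition_series N M n (F : nat -> set K) : Prop :=
  [/\ F 0%N = N, F n = M, (forall i, (i <= n)%N -> submodule (F i)) &
      forall i, (i < n)%N -> F i `<` F i.+1 /\
        (forall L, submodule L -> F i `<=` L -> L `<=` F i.+1 ->
           L = F i \/ L = F i.+1)].

(* The length of M / N, or 0 if it is infinite. *)
Definition length_quot N M : nat :=
  xget 0%N [set n | exists F, composition_series N M n F].

Definition principal_ideal a : set K := [set a * x | x in [set` A]].

End Modules.

Identity Coercion fun_of_set : set >-> Funclass.

Record maxSpec (K : fieldType) (A : {pred K}) := MaxSpec {
  max_ideal :> set K;
  max_idealP : `[< maximal_ideal A max_ideal >] }.
HB.instance Definition _ (K : fieldType) (A : {pred K}) :=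
  [isSub for @max_ideal K A].
HB.instance Definition _ (K : fieldType) (A : {pred K}) :=
  [Choice of maxSpec A by <:].

Section MaximalIdeals.
Variables (K : fieldType) (A : subringClosed K) (p : maxSpec A).

Lemma maxSpecP : maximal_ideal A p.
Proof. by case: p => I /= /asboolP. Qed.

Lemma maxSpec_sub x : p x -> x \in A.
Proof. by case: maxSpecP => -[_ pA] _ _ /pA. Qed.

Lemma maxSpec0 : p 0. Proof. by case: maxSpecP => -[[]]. Qed.

Lemma maxSpecD x y : p x -> p y -> p (x + y).
Proof.
case: maxSpecP => -[[_ pD] _] _ _ px py.
by rewrite -[x]mul1r; apply: pD => //; exact: rpred1.
Qed.

Lemma maxSpecM a x : a \in A -> p x -> p (a * x).
Proof.
case: maxSpecP => -[[p0 pD] _] _ _ aA px.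
by rewrite -[_ * _]addr0; exact: pD.
Qed.

Lemma maxSpecN x : p x -> p (- x).
Proof.
by move=> px; rewrite -mulN1r; apply: maxSpecM => //; rewrite rpredN rpred1.
Qed.

Lemma maxSpec_inv x : x \in A -> ~ p x -> exists2 y, y \in A & p (x * y - 1).
Proof.
move=> xA npx; case: (maxSpecP) => -[[p0 pD] pA] p1 pmax.
pose J : set K := [set z | exists a b, [/\ p a, b \in A & z = a + x * b]].
have JI : ideal A J.
  split; [split|].
  - by exists 0, 0; rewrite rpred0 mulr0 addr0.
  - move=> c _ _ cA [a [b [pa bA ->]]] [a' [b' [pa' bA' ->]]].
    exists (c * a + a'), (c * b + b'); split; first exact: pD.
      by rewrite rpredD// rpredM.
    by rewrite !mulrDr addrACA mulrCA.
  - by move=> _ [a [b [/pA/= aA bA ->]]] /=; rewrite rpredD// rpredM.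
have pJ : p `<=` J by move=> z pz; exists z, 0; rewrite rpred0 mulr0 addr0.
case: (pselect (J 1)) => [[a [b [pa bA e]]] | nJ1].
  exists b => //; rewrite e opprD addrCA subrr addr0.
  exact: maxSpecN.
exfalso; apply: npx; rewrite -(pmax J)//.
by exists 0, 1; rewrite rpred1 mulr1 add0r.
Qed.

Lemma maxSpec_prime x y : x \in A -> y \in A -> p (x * y) -> p x \/ p y.
Proof.
move=> xA yA pxy; case: (pselect (p x)) => [|npx]; [by left|right].
have [z zA pxz] := maxSpec_inv xA npx.
have -> : y = z * (x * y) + - (y * (x * z - 1)).
  by rewrite mulrBr mulr1 opprB mulrCA [y * _]mulrC -!mulrA [z * y]mulrC
    addrCA subrr addr0.
by apply: maxSpecD; [exact: maxSpecM | apply: maxSpecN; exact: maxSpecM].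
Qed.

End MaximalIdeals.

Section Localization.
Variables (K : fieldType) (A : subringClosed K) (p : maxSpec A).

Definition localization : {pred K} := fun x =>
  `[< exists a s, [/\ a \in A, s \in A, ~ p s & x = a / s] >].

Lemma compl_neq0 s : ~ p s -> s != 0.
Proof. by apply: contra_notN => /eqP ->; exact: maxSpec0. Qed.

Lemma compl1 : ~ p 1. Proof. by case: (maxSpecP p). Qed.

Lemma complM s t : s \in A -> t \in A -> ~ p s -> ~ p t -> ~ p (s * t).
Proof. by move=> sA tA ps pt /(maxSpec_prime sA tA)[]. Qed.

Lemma localization_subring_closed : subring_closed localization.
Proof.
split.
- by apply/asboolP; exists 1, 1; rewrite rpred1 divr1; split=> //; exact: compl1.
- move=> _ _ /asboolP[a [s [aA sA ps ->]]] /asboolP[b [t [bA tA pt ->]]].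
  apply/asboolP; exists (a * t - b * s), (s * t).
  split; [by rewrite rpredB// rpredM | by rewrite rpredM | exact: complM |].
  by rewrite -[- (b / t)]mulNr addf_div ?compl_neq0// mulNr.
- move=> _ _ /asboolP[a [s [aA sA ps ->]]] /asboolP[b [t [bA tA pt ->]]].
  apply/asboolP; exists (a * b), (s * t).
  split; [by rewrite rpredM | by rewrite rpredM | exact: complM |].
  by rewrite mulf_div.
Qed.
HB.instance Definition _ :=
  GRing.isSubringClosed.Build K localization localization_subring_closed.

Definition localization_ideal : set K :=
  [set x | exists a s, [/\ p a, s \in A, ~ p s & x = a / s]].

Lemma localization_ideal_maximal : maximal_ideal localization localization_ideal.
Proof.
split; first split; first split.
- by exists 0, 1; rewrite rpred1 mul0r; split=> //; [exact: maxSpec0|exact: compl1].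
- move=> _ _ _ /asboolP[c [u [cA uA pu ->]]] [a [s [pa sA ps ->]]]
    [b [t [pb tA pt ->]]].
  exists (c * a * t + b * (u * s)), (u * s * t).
  split; last by rewrite mulf_div addf_div ?mulf_neq0 ?compl_neq0.
  + apply: maxSpecD; rewrite mulrC; apply: maxSpecM => //; last exact: rpredM.
    exact: maxSpecM.
  + by rewrite !rpredM.
  + by apply: complM => //; [rewrite rpredM | exact: complM].
- move=> _ [a [s [pa sA ps ->]]]; apply/asboolP; exists a, s; split=> //.
  exact: maxSpec_sub pa.
- move=> [a [s [pa sA ps]]] /(congr1 ( *%R^~ s)).
  by rewrite mul1r mulfVK ?compl_neq0// => sa; apply: ps; rewrite sa.
- move=> J [[J0 JD] JA] nJ1 pJ; apply/seteqP; split=> // x Jx.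
  have /asboolP[a [s [aA sA ps xE]]] := JA _ Jx.
  exists a, s; split=> //; apply: contrapT => npa; apply: nJ1.
  have -> : 1 = (s / a) * x + 0.
    by rewrite addr0 xE mulf_div [s * a]mulrC divff ?mulf_neq0 ?compl_neq0.
  by apply: JD => //; apply/asboolP; exists s, a.
Qed.

Definition loc_max : maxSpec localization :=
  MaxSpec (asboolT localization_ideal_maximal).

End Localization.

Section Normalization.
Variables (K : fieldType) (A : subringClosed K).

Record subring := Subring { subring_val :> K; _ : subring_val \in A }.
HB.instance Definition _ := [isSub for subring_val].
HB.instance Definition _ := [Choice of subring by <:].
HB.instance Definition _ := [SubChoice_isSubComNzRing of subring by <:].

Definition normalization : {pred K} :=
  fun x => `[< integralOver (val : subring -> K) x >].

Lemma normalization_subring_closed : subring_closed normalization.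
Proof.
split.
- by apply/asboolP; exact: integral1.
- by move=> x y /asboolP ix /asboolP iy; apply/asboolP; exact: integral_sub.
- by move=> x y /asboolP ix /asboolP iy; apply/asboolP; exact: integral_mul.
Qed.
HB.instance Definition _ :=
  GRing.isSubringClosed.Build K normalization normalization_subring_closed.

Lemma sub_normalization x : x \in A -> x \in normalization.
Proof. by move=> xA; apply/asboolP; exact: (integral_id _ (Subring xA)). Qed.

Definition contraction_ideal (P : set K) : set K := P `&` [set` A].

Lemma contraction_inv (P : maxSpec normalization) x :
  x \in A -> ~ P x -> exists2 z, z \in A & P (x * z - 1).
Proof.
move=> xA nPx; have [y yB Pxy] := maxSpec_inv (sub_normalization xA) nPx.
have /asboolP[q qmon qy0] := yB.
set n := (size q).-1; have sq : size q = n.+1.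
  by rewrite /n prednK// size_poly_gt0 monic_neq0.
have P_exp i : P ((x * y) ^+ i - 1).
  elim: i => [|i IHi]; first by rewrite expr0 subrr; exact: maxSpec0.
  have -> : (x * y) ^+ i.+1 - 1 = (x * y) ^+ i * (x * y - 1) + ((x * y) ^+ i - 1).
    by rewrite exprSr mulrBr mulr1 addrA subrK.
  apply: maxSpecD => //; apply: maxSpecM => //.
  by rewrite rpredX// rpredM// sub_normalization.
have [c cA [c1 cy0]] : exists2 c : nat -> K, (forall i, c i \in A) &
    c n = 1 /\ \sum_(i < n.+1) c i * y ^+ i = 0.
  exists (fun i => val q`_i); first by move=> i; exact: valP.
  split; first by move/monicP: qmon; rewrite lead_coefE -/n => ->.
  move/rootP: qy0; rewrite horner_coef (size_map_inj_poly val_inj) ?rmorph0//.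
  rewrite sq => y0; rewrite -[RHS]y0; apply: eq_bigr => i _.
  by rewrite coef_map_id0 ?rmorph0.
pose w := \sum_(i < n) c i * x ^+ (n.-1 - i).
have wA : w \in A by rewrite rpred_sum// => i _; rewrite rpredM// rpredX.
exists (- w); first by rewrite rpredN.
have -> : x * - w - 1 =
    \sum_(i < n.+1) c i * x ^+ (n - i) * ((x * y) ^+ i - 1).
  under eq_bigr do rewrite mulrBr mulr1.
  rewrite sumrB.
  have -> : \sum_(i < n.+1) c i * x ^+ (n - i) * (x * y) ^+ i = 0.
    transitivity (x ^+ n * \sum_(i < n.+1) c i * y ^+ i); last by rewrite cy0 mulr0.
    rewrite mulr_sumr; apply: eq_bigr => i _.
    have -> : x ^+ n = x ^+ (n - i) * x ^+ i by rewrite -exprD subnK ?leq_ord.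
    by rewrite exprMn [c i * _]mulrC -!mulrA; congr (_ * _); rewrite mulrCA.
  rewrite sub0r big_ord_recr/= subnn expr0 mulr1 c1.
  rewrite opprD mulrN mulr_sumr; congr (- _ - _).
  apply: eq_bigr => i _; rewrite mulrCA -exprS; congr (_ * _ ^+ _).
  by case: n i {w wA sq c1 cy0} => [[]//|m] i /=; rewrite subSn// -ltnS.
apply: big_ind; [exact: maxSpec0 | exact: maxSpecD | move=> i _].
apply: maxSpecM; last exact: P_exp.
by apply: sub_normalization; rewrite rpredM// rpredX.
Qed.

Lemma contraction_maximal (P : maxSpec normalization) :
  maximal_ideal A (contraction_ideal P).
Proof.
split; first split; first split.
- by split; [exact: maxSpec0 | exact: rpred0].
- move=> a x y aA [Px xA] [Py yA]; split; last by rewrite /= rpredD// rpredM.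
  by apply: maxSpecD => //; apply: maxSpecM => //; exact: sub_normalization.
- by move=> x [].
- by case=> P1 _; case: (maxSpecP P) => _ /(_ P1).
- move=> J [[J0 JD] JA] nJ1 PJ; apply/seteqP; split=> // x Jx.
  split; last exact: JA.
  apply: contrapT => nPx; have xA := JA _ Jx.
  have [z zA Pxz] := contraction_inv xA nPx; apply: nJ1.
  have Jxz : J (x * z - 1) by apply: PJ; split=> //=; rewrite rpredB ?rpred1// rpredM.
  have -> : 1 = -1 * (x * z - 1) + (z * x + 0).
    by rewrite mulN1r opprB addr0 [z * x]mulrC subrK.
  by apply: (JD); [rewrite rpredN rpred1 | | apply: (JD)].
Qed.

Definition contraction (P : maxSpec normalization) : maxSpec A :=
  MaxSpec (asboolT (contraction_maximal P)).

End Normalization.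

(* The degree of B / P over A / (P `&` A), through representatives e of a
   basis; 0 if it is infinite. *)
Section ResidueDegree.
Variables (K : fieldType) (A B : {pred K}) (P : set K).

Definition residue_basis n (e : 'I_n -> K) : Prop :=
  [/\ (forall i, e i \in B),
      (forall x, x \in B -> exists2 c : 'I_n -> K,
         (forall i, c i \in A) & P (x - \sum_i c i * e i)) &
      (forall c : 'I_n -> K, (forall i, c i \in A) ->
         P (\sum_i c i * e i) -> forall i, P (c i))].

Definition residue_degree : nat :=
  xget 0%N [set n | exists e : 'I_n -> K, residue_basis e].

End ResidueDegree.

Section Divisors.
Variables (K : fieldType) (A : subringClosed K).

Definition Div : zmodType := {freeg (maxSpec A) / int}.

Definition loc_length (p : maxSpec A) (a : K) : nat :=
  length_quot (localization p) (principal_ideal (localization p) a)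
    [set` localization p].

(* The value does not depend on the choice of the fraction a / b. *)
Definition ord (p : maxSpec A) (x : K) : int :=
  xget 0 [set z | exists a b,
    [/\ a \in A /\ b \in A, a != 0, b != 0, x = a / b &
        z = (loc_length p a)%:Z - (loc_length p b)%:Z]].

(* The sum is over p such that ord p x != 0; there are finitely many. *)
Definition div (x : K) : Div :=
  \sum_(p \in [set: maxSpec A]) << ord p x *g p >>.

Definition principal_divisors : set Div :=
  [set D | exists2 x, x != 0 & D = div x].

(* ord p is a homomorphism, so the principal divisors form a subgroup. *)
Definition Chow : zmodType := quotient principal_divisors.

Definition divisor_class : {additive Div -> Chow} :=
  @quot_class Div principal_divisors.

End Divisors.

Section Pushforward.
Variables (K : fieldType) (O : subringClosed K).

Definition degree (P : maxSpec (normalization O)) : nat :=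
  residue_degree O (normalization O) P.

Definition pushforward (D : Div (normalization O)) : Div O :=
  \sum_(P <- dom D) << coeff P D * (degree P)%:Z *g contraction P >>.

(* Since the classes of divisors exhaust the Chow group, there is at most one
   such homomorphism. *)
Definition induced_by_pushforward
    (f : {additive Chow (normalization O) -> Chow O}) : Prop :=
  forall D, f (divisor_class _ D) = divisor_class _ (pushforward D).

Definition local_chow (p : maxSpec O) : zmodType := Chow (localization p).

Definition localize_divisor (D : Div O) (p : maxSpec O) : local_chow p :=
  divisor_class (localization p) << coeff p D *g loc_max p >>.

Definition induced_by_localization
    (f : {additive Chow O -> dsum local_chow}) : Prop :=
  forall D p, f (divisor_class _ D) p = localize_divisor D p.

End Pushforward.
Arguments local_chow {K} O p.

(* Main.v *)
Require Import Defs.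
From HB Require Import structures.
From mathcomp.multinomials Require Import freeg.
From mathcomp Require Import all_boot all_order all_algebra.
From mathcomp Require Import all_classical.
From mathcomp Require Import ring zify.

(** Write Ot for the normalization of O. Everything rests on two facts about the
    order homomorphisms at a maximal ideal p of O.

    The first is that the push-forward of the divisor of x on Ot is the divisor
    of x on O. Take x = a in O. The order of a at p is the length of O_p / a O_p,
    and also the length over O_p of Ot_p / a Ot_p: both Ot_p / O_p and
    a Ot_p / a O_p have the same finite length, which can be cancelled. Now filter
    Ot / a Ot by Ot-submodules with simple quotients Ot / P. Localizing a factor
    Ot / P at p kills it if P does not lie over p, and otherwise gives an
    O_p-module whose length is the degree of P. Localizing at P instead shows that
    P occurs as often in the filtration as the order of a at P. So one list of
    maximal ideals computes both divisors ([factors_localized],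
    [loc_length_pushforward], [pushforward_div]). The filtrations exist since
    quotients of O by nonzero ideals have finite length ([dim1_finite_colength]),
    a property that passes to finite extensions and to localizations.

    The second is that the orders at p of the elements of K^* form the subgroup
    of the integers generated by the degrees of the P over p ([ord_image_gcd]). By
    the first fact they are combinations of these degrees. Conversely, each
    localization of Ot has a principal maximal ideal ([norm_uniformizer]), so weak
    approximation ([approximation]) yields x of order 1 at a chosen P and 0 at the
    other ideals over p; the order of x at p is the degree of P. At an invertible
    p the maximal ideal of O_p is itself principal, and every integer is an order.

    The divisor group of the local ring O_p is the group of integers, so its Chow
    group is the quotient of the integers by the group of orders at p: this gives
    the local Chow groups. A divisor class is in the kernel of the localization
    map when each coefficient is an order, say of x_p at p. By the first fact that
    coefficient is then obtained by pushing forward the part over p of the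
    divisor of x_p on Ot, so the class comes from Chow(Ot)
    ([pushforward_of_locally_principal]). Conversely the coefficients of a
    push-forward are combinations of degrees, hence orders. *)

Set Implicit Arguments.
Unset Strict Implicit.
Unset Printing Implicit Defensive.

Import GRing.Theory.
Local Open Scope classical_set_scope.
Local Open Scope ring_scope.

(** * Lengths of submodules of a field *)

Section Length.
Variables (K : fieldType) (A : subringClosed K).
Implicit Types (L M N X Y : set K).

Lemma submod0 M : submodule A M -> M 0. Proof. by case. Qed.

Lemma submodD M x y : submodule A M -> M x -> M y -> M (x + y).
Proof. by move=> [_ h] Mx My; rewrite -[x]mul1r; apply: h => //; exact: rpred1. Qed.

Lemma submodM M a x : submodule A M -> a \in A -> M x -> M (a * x).
Proof. by move=> [M0 h] aA Mx; rewrite -[_ * _]addr0; exact: h. Qed.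

Lemma submodN M x : submodule A M -> M x -> M (- x).
Proof.
by move=> sM Mx; rewrite -mulN1r; apply: submodM => //; rewrite rpredN rpred1.
Qed.

Lemma submodB M x y : submodule A M -> M x -> M y -> M (x - y).
Proof. by move=> sM Mx My; apply: submodD => //; exact: submodN. Qed.

Lemma submod_sum M (I : Type) (s : seq I) (F : I -> K) : submodule A M ->
  (forall i, M (F i)) -> M (\sum_(i <- s) F i).
Proof.
move=> sM MF; apply: big_ind => //; first exact: submod0.
by move=> x y; exact: submodD.
Qed.

Lemma submod_ring : submodule A [set` A].
Proof.
by split=> [|a x y aA xA yA] /=; rewrite ?rpred0 ?rpredD ?rpredM.
Qed.

Definition msum M N : set K := [set z | exists x y, [/\ M x, N y & z = x + y]].

Lemma submod_msum M N : submodule A M -> submodule A N -> submodule A (msum M N).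
Proof.
move=> sM sN; split.
  by exists 0, 0; rewrite addr0; split=> //; exact: submod0.
move=> a _ _ aA [x [y [Mx Ny ->]]] [x' [y' [Mx' Ny' ->]]].
exists (a * x + x'), (a * y + y'); split.
- by apply: submodD => //; exact: submodM.
- by apply: submodD => //; exact: submodM.
- by rewrite mulrDr addrACA.
Qed.

Lemma submod_cap M N : submodule A M -> submodule A N -> submodule A (M `&` N).
Proof.
move=> sM sN; split; first by split; exact: submod0.
move=> a x y aA [Mx Nx] [My Ny].
by split; apply: submodD => //; exact: submodM.
Qed.

Lemma msumL M N : submodule A N -> M `<=` msum M N.
Proof. by move=> sN x Mx; exists x, 0; rewrite addr0; split=> //; exact: submod0. Qed.

Lemma msumR M N : submodule A M -> N `<=` msum M N.
Proof. by move=> sN x Mx; exists 0, x; rewrite add0r; split=> //; exact: submod0. Qed.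

Lemma msum_sub M N X : submodule A X -> M `<=` X -> N `<=` X -> msum M N `<=` X.
Proof. by move=> sX MX NX _ [x [y [/MX Xx /NX Xy ->]]]; exact: submodD. Qed.

Definition scale (c : K) M : set K := [set c * x | x in M].

Lemma submod_scale c M : submodule A M -> submodule A (scale c M).
Proof.
move=> sM; split; first by exists 0; rewrite ?mulr0//; exact: submod0.
move=> a _ _ aA [x Mx <-] [y My <-]; exists (a * x + y).
  by apply: submodD => //; exact: submodM.
by rewrite mulrDr mulrCA.
Qed.

Lemma scaleK c M : c != 0 -> scale c^-1 (scale c M) = M.
Proof.
move=> c0; apply/seteqP; split=> [_ [_ [x Mx <-] <-]|x Mx].
  by rewrite mulKf.
by exists (c * x); [exists x | rewrite mulKf].
Qed.

Lemma scaleVK c M : c != 0 -> scale c (scale c^-1 M) = M.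
Proof. by move=> c0; rewrite -{1}[c]invrK scaleK// invr_eq0. Qed.

Lemma scale_sub c M N : M `<=` N -> scale c M `<=` scale c N.
Proof. by move=> MN _ [x /MN Nx <-]; exists x. Qed.

Lemma scaleA a b M : scale (a * b) M = scale a (scale b M).
Proof.
apply/seteqP; split=> [_ [x Mx <-]|_ [_ [x Mx <-] <-]].
  by exists (b * x); [exists x|rewrite mulrA].
by exists x => //; rewrite mulrA.
Qed.

(** Expresses, without forming quotients, that [M / N] is simple. *)
Definition cover N M : Prop :=
  [/\ submodule A N, submodule A M, N `<` M &
      forall L, submodule A L -> N `<=` L -> L `<=` M -> L = N \/ L = M].

(** Inductive form of composition series, which supports proofs by induction on
    the top of the series. *)
Inductive has_length N : set K -> nat -> Prop :=
| has_length0 : submodule A N -> has_length N N 0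
| has_lengthS M M' n : has_length N M n -> cover M M' -> has_length N M' n.+1.

Lemma has_length_submodl N M n : has_length N M n -> submodule A N.
Proof. by elim. Qed.

Lemma has_length_submodr N M n : has_length N M n -> submodule A M.
Proof. by elim=> // {}M M' m _ _ []. Qed.

Lemma has_length_sub N M n : has_length N M n -> N `<=` M.
Proof.
move=> h; elim: h => [_ //|X Y k _ NX [_ _ [XY _] _]]; exact: (subset_trans NX XY).
Qed.

Lemma cover_length N M : cover N M -> has_length N M 1.
Proof. by move=> c; apply: has_lengthS (c); apply: has_length0; case: c. Qed.

Lemma has_length_trans N L M n k :
  has_length N L n -> has_length L M k -> has_length N M (n + k).
Proof.
move=> hN; elim=> [_|X Y m _ IH c]; first by rewrite addn0.
by rewrite addnS; exact: has_lengthS c.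
Qed.

Lemma has_lengthP N M n :
  has_length N M n <-> exists F, composition_series A N M n F.
Proof.
split.
  elim=> [sN|X Y m _ [F [F0 Fm sF cF]] [sX sY XY c]].
    by exists (fun=> N); split=> //.
  exists (fun i => if (i <= m)%N then F i else Y); split=> //.
  - by rewrite ltnn.
  - by move=> i _; case: ifP => // im; exact: sF.
  - move=> i; rewrite ltnS leq_eqVlt => /predU1P[->|im].
      by rewrite eqxx ltnn Fm.
    by rewrite im orbT; exact: cF.
elim: n M => [|n IH] M [F [F0 Fn sF cF]].
  by rewrite -Fn F0; apply: has_length0; rewrite -F0; exact: sF.
apply: (@has_lengthS N (F n)).
  apply: IH; exists F; split=> // i im; first by apply: sF; exact: ltnW.
  by apply: cF; exact: ltnW.
have [Fnn c] := cF n (leqnn _).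
by rewrite -Fn; split=> //; exact: sF.
Qed.

Lemma cover_scale c N M : c != 0 -> cover N M -> cover (scale c N) (scale c M).
Proof.
move=> c0 [sN sM [NM nMN] cNM]; split; try exact: submod_scale.
  split; first exact: scale_sub.
  by move=> /(@scale_sub c^-1); rewrite !scaleK.
move=> L sL /(@scale_sub c^-1) + /(@scale_sub c^-1); rewrite !scaleK // => NL LM.
by have [|||e|e] := cNM (scale c^-1 L); rewrite -?e ?scaleVK; auto;
  exact: submod_scale.
Qed.

Lemma has_length_scale c N M n : c != 0 ->
  has_length N M n -> has_length (scale c N) (scale c M) n.
Proof.
move=> c0; elim=> [sN|X Y m _ IH cXY].
  by apply: has_length0; exact: submod_scale.
by apply: has_lengthS IH _; exact: cover_scale.
Qed.

(** By the modular law, [X |-> X + L] is an isomorphism from the lattice of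
    submodules between [M `&` L] and [M] onto that between [L] and [M + L], with
    inverse [Y |-> Y `&` M]. *)
Lemma cover_addr L M X Y : submodule A L -> submodule A M ->
  M `&` L `<=` X -> Y `<=` M -> cover X Y -> cover (msum X L) (msum Y L).
Proof.
move=> sL sM LX YM [sX sY [XY nYX] c].
have modular Z : submodule A Z -> M `&` L `<=` Z -> Z `<=` M ->
    msum Z L `&` M = Z.
  move=> sZ LZ ZM; apply/seteqP; split; last first.
    by move=> z Zz; split; [exact: msumL|exact: ZM].
  move=> _ [[x [y [Zx Ly ->]]] Mxy]; apply: submodD => //; apply: LZ; split=> //.
  by rewrite -[y](addKr x) addrC; apply: submodB => //; exact: ZM.
have XM : X `<=` M by exact: (subset_trans XY YM).
have LY : M `&` L `<=` Y by exact: (subset_trans LX XY).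
split; try exact: submod_msum.
  split; first by apply: msum_sub; [exact: submod_msum|
    exact: (subset_trans XY (msumL _))|exact: msumR].
  move=> YLX; apply: nYX => y Yy; rewrite -(modular X)//; split; last exact: YM.
  by apply: YLX; exact: msumL.
move=> Z sZ XZ ZY.
have ZE : Z = msum (Z `&` Y) L.
  apply/seteqP; split; last first.
    apply: msum_sub => //.
    by apply: (subset_trans _ XZ); exact: msumR.
  move=> z Zz; have [y [l [Yy Ll zE]]] := ZY _ Zz; exists y, l; split=> //.
  split=> //; have -> : y = z - l by rewrite zE addrK.
  by apply: submodB => //; apply: XZ; exact: msumR.
have [|||e|e] := c (Z `&` Y).
- exact: submod_cap.
- by move=> x Xx; split; [apply: XZ; exact: msumL|exact: XY].
- exact: subIsetr.
- by left; rewrite ZE e.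
- by right; rewrite ZE e.
Qed.

Lemma has_length_addr L M N n : submodule A L -> has_length N M n ->
  M `&` L `<=` N -> has_length (msum N L) (msum M L) n.
Proof.
move=> sL h.
suff H M0 : submodule A M0 -> M `<=` M0 -> M0 `&` L `<=` N ->
    has_length (msum N L) (msum M L) n.
  by apply: H => //; exact: has_length_submodr h.
move=> sM0; elim: h => [sN _ LN|X Y m hX IH cXY YM LN].
  by apply: has_length0; exact: submod_msum.
have XY : X `<=` Y by case: cXY => _ _ [].
apply: has_lengthS; first by apply: IH => //; exact: (subset_trans XY YM).
by apply: (@cover_addr L M0) => //; exact: (subset_trans LN (has_length_sub hX)).
Qed.

(** Induction on the series. If its last term but one, [X], does not contain [L],
    then [L / (X `&` L)] is isomorphic to the simple top quotient, and
    [X / (X `&` L)] is isomorphic to the quotient by [L]. *)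
Lemma has_length_between N M L n : has_length N M n -> submodule A L ->
  N `<=` L -> L `<=` M ->
  exists n1 n2, [/\ has_length N L n1, has_length L M n2 & n = (n1 + n2)%N].
Proof.
move=> h; elim: h L => [sN|X Y m hX IH cXY] L sL NL LM.
  have -> : L = N by apply/seteqP.
  by exists 0%N, 0%N; split=> //; exact: has_length0.
have [sX sY [XY nYX] c] := cXY.
have [n1 [n2 [h1 h2 mE]]] : exists n1 n2,
    [/\ has_length N (X `&` L) n1, has_length (X `&` L) X n2 & m = (n1 + n2)%N].
  apply: IH; [exact: submod_cap| |exact: subIsetl].
  by move=> x Nx; split; [exact: (has_length_sub hX)|exact: NL].
have sXL := submod_cap sX sL.
case: (pselect (L `<=` X)) => LX.
  have XLE : X `&` L = L by apply/seteqP; split=> [x []|x Lx] //; split=> //; exact: LX.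
  rewrite XLE in h1 h2.
  exists n1, n2.+1; split=> //; last by rewrite addnS mE.
  exact: has_lengthS cXY.
have XLY : msum X L = Y.
  case: (c (msum X L)) => //; first exact: submod_msum.
  - exact: msumL.
  - exact: msum_sub.
  - by move=> e; exfalso; apply: LX; rewrite -e; exact: msumR.
exists n1.+1, n2; split=> //; last by rewrite mE addSn.
- apply: has_lengthS h1 _; split=> //.
    by split; [exact: subIsetr|move=> LXL; apply: LX => x /LXL[]].
  move=> Z sZ XLZ ZL.
  have [|||e|e] := c (msum X Z); first exact: submod_msum.
  + exact: msumL.
  + by apply: msum_sub => //; exact: (subset_trans _ LM).
  + left; apply/seteqP; split=> // x Zx; split; last exact: ZL.
    by rewrite -e; exact: msumR.
  + right; apply/seteqP; split=> // x Lx.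
    have [u [z [Xu Zz xE]]] : msum X Z x by rewrite e; exact: LM.
    rewrite xE; apply: submodD => //; apply: XLZ; split=> //.
    by have -> : u = x - z by [rewrite xE addrK]; apply: submodB => //; exact: ZL.
- have := has_length_addr sL h2 (@subset_refl _ _).
  rewrite XLY; congr (has_length _ _ _); apply/seteqP; split; last exact: msumR.
  by apply: msum_sub => //; exact: subIsetr.
Qed.

(** Jordan-Hoelder: the last term but one of the first series cuts the interval
    into two, and the second series is spread over both by
    [has_length_between]. *)
Lemma has_length_unique N M n m : has_length N M n -> has_length N M m -> n = m.
Proof.
move=> h; elim: h m => {M n} [sN|X Y n hX IH cXY] m.
  move E : {2}N => N' h; case: h E => // M M' k h [_ _ [MM' nM'M] _] E.
  by exfalso; apply: nM'M; rewrite -E; exact: has_length_sub h.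
have [sX sY [XY nYX] c] := cXY => hY.
have [m1 [m2 [h1 h2 ->]]] := has_length_between hY sX (has_length_sub hX) XY.
rewrite -(IH _ h1) -addn1; congr (_ + _)%N.
case: h2 c XY nYX => // {cXY sY hY} X' Z k hX' [sX' sZ [XZ nZX] _] c _ _.
have [||E|E] := c _ sX' => //; first exact: has_length_sub hX'.
  case: hX' E => // V W l hV [_ _ [VW nWV] _] E; exfalso; apply: nWV.
  by rewrite E; exact: has_length_sub hV.
by exfalso; apply: nZX; rewrite E.
Qed.

Lemma length_quotE N M n : has_length N M n -> length_quot A N M = n.
Proof.
move=> h; apply: xget_unique; first exact/has_lengthP.
by move=> m /has_lengthP hm; exact: has_length_unique hm h.
Qed.

Lemma has_length_first N M n : has_length N M n -> N <> M ->
  exists2 N', cover N N' & N' `<=` M.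
Proof.
elim=> // X Y m hX IH cXY NY; case: (pselect (N = X)) => NX.
  by exists Y => //; rewrite NX.
have [N' c N'X] := IH NX; exists N' => //; apply: (subset_trans N'X).
by case: cXY => _ _ [].
Qed.

Lemma has_length0E N M : has_length N M 0 -> M = N.
Proof. by move E : 0%N => n h; case: h E. Qed.

End Length.

Lemma submod_restrict (K : fieldType) (A B : subringClosed K) (M : set K) :
  {subset A <= B} -> submodule B M -> submodule A M.
Proof. by move=> AB [M0 h]; split=> // a x y /AB; exact: h. Qed.

(** Over the larger ring there are fewer submodules, so a series is found by
    inserting submodules as long as possible; the length over [A] bounds the
    number of insertions. *)
Lemma has_length_extend (K : fieldType) (A B : subringClosed K) (N M : set K) n :
  {subset A <= B} -> submodule B N -> submodule B M ->
  has_length A N M n -> exists m, has_length B N M m.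
Proof.
move=> AB; elim: n {-2}n (leqnn n) N M => [|k IH] n nk N M sN sM h.
  move: nk h; rewrite leqn0 => /eqP -> /has_length0E ->.
  by exists 0%N; exact: has_length0.
case: (pselect (N = M)) => [<-|NM]; first by exists 0%N; exact: has_length0.
have subNM := has_length_sub h.
case: (pselect (exists L, [/\ submodule B L, N `<=` L, L `<=` M, L <> N & L <> M])).
  move=> [L [sL NL LM LN LM']].
  have [n1 [n2 [h1 h2 nE]]] := has_length_between h (submod_restrict AB sL) NL LM.
  have n1_gt0 : (0 < n1)%N.
    by case: n1 h1 {nE} => // /has_length0E.
  have n2_gt0 : (0 < n2)%N.
    by case: n2 h2 {nE} => // /has_length0E /esym.
  have [m1 hm1] : exists m, has_length B N L m by apply: (IH n1) => //; lia.
  have [m2 hm2] : exists m, has_length B L M m by apply: (IH n2) => //; lia.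
  by exists (m1 + m2)%N; exact: has_length_trans hm1 hm2.
move=> noL; exists 1%N; apply: cover_length; split=> //.
  by split=> // MN; apply: NM; apply/seteqP.
move=> L sL NL LM; case: (pselect (L = N)) => LN; first by left.
by right; apply: contrapT => LM'; apply: noL; exists L.
Qed.

(** * Simple quotients and their localizations *)

Section CoverGenerator.
Variables (K : fieldType) (B : subringClosed K).
Implicit Types (N M : set K).

(** A simple module is generated by each of its nonzero elements. *)
Lemma cover_gen N M m0 m : cover B N M -> M m0 -> ~ N m0 -> M m ->
  exists n b, [/\ N n, b \in B & m = n + b * m0].
Proof.
move=> [sN sM [NM nMN] c] Mm0 Nm0 Mm.
pose L : set K := [set x | exists n b, [/\ N n, b \in B & x = n + b * m0]].
have NL : N `<=` L by move=> x Nx; exists x, 0; rewrite mul0r addr0 rpred0.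
have Lm0 : L m0.
  by exists 0, 1; rewrite mul1r add0r rpred1; split=> //; exact: (submod0 sN).
have [|||e|e] := c L.
- split; first by apply: NL; exact: (submod0 sN).
  move=> a _ _ aB [x [b [Nx bB ->]]] [y [d [Ny dB ->]]].
  exists (a * x + y), (a * b + d); split.
  + by apply: (submodD sN) => //; exact: (submodM sN).
  + by rewrite rpredD// rpredM.
  + by ring.
- exact: NL.
- by move=> _ [x [b [/NM Mx bB ->]]]; apply: (submodD sM) => //; exact: (submodM sM).
- by exfalso; apply: Nm0; rewrite -e.
- by have : L m by rewrite e.
Qed.

Lemma cover_elt N M : cover B N M -> exists2 m0, M m0 & ~ N m0.
Proof.
move=> [_ _ [NM nMN] _]; apply: contrapT => h; apply: nMN => m Mm.
by apply: contrapT => Nm; apply: h; exists m.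
Qed.

Definition annihilates (I N M : set K) := forall x m, I x -> M m -> N (x * m).

(** A simple module [M / N] is [B m0] for any [m0] outside [N], hence [B / I]
    with [I] the annihilator of [m0] modulo [N]; simplicity makes [I] maximal. *)
Lemma cover_annihilator N M : cover B N M ->
  exists P : maxSpec B, annihilates P N M.
Proof.
move=> cNM; have [m0 Mm0 Nm0] := cover_elt cNM.
have [sN sM [NM _] _] := cNM.
pose I : set K := [set b | b \in B /\ N (b * m0)].
have I_max : maximal_ideal B I.
  split; first split; first split.
  - by split; [exact: rpred0|rewrite mul0r; exact: (submod0 sN)].
  - move=> a x y aB [xB Nx] [yB Ny]; split; first by rewrite rpredD// rpredM.
    by rewrite mulrDl -mulrA; apply: (submodD sN) => //; exact: (submodM sN).
  - by move=> x [].
  - by case=> _; rewrite mul1r.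
  - move=> J [sJ JB] J1 IJ; apply/seteqP; split=> // x Jx; split; first exact: JB.
    apply: contrapT => Nx.
    have Mx : M (x * m0) by apply: (submodM sM) => //; exact: JB.
    have [n [b [Nn bB e]]] := cover_gen cNM Mx Nx Mm0.
    apply: J1; have -> : 1 = (1 - b * x) + b * x by rewrite subrK.
    apply: (submodD sJ); last exact: (submodM sJ).
    apply: IJ; split; first by rewrite rpredB ?rpred1// rpredM//; exact: JB.
    rewrite mulrBl mul1r {1}e -mulrA addrK//.
exists (MaxSpec (asboolT I_max)) => x m [xB Nx] Mm.
have [n [b [Nn bB ->]]] := cover_gen cNM Mm0 Nm0 Mm.
by rewrite mulrDr mulrCA; apply: (submodD sN) => //; exact: (submodM sN).
Qed.

Lemma annihilates_ideal N M (P : maxSpec B) m0 b : submodule B N ->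
  annihilates P N M -> M m0 -> ~ N m0 -> b \in B -> N (b * m0) -> P b.
Proof.
move=> sN PNM Mm0 Nm0 bB Nb; apply: contrapT => Pb.
have [y yB Py] := maxSpec_inv bB Pb.
apply: Nm0; have -> : m0 = y * (b * m0) - (b * y - 1) * m0 by ring.
by apply: (submodB sN); [exact: (submodM sN) | exact: PNM].
Qed.

End CoverGenerator.

Section LocalizedModule.
Variables (K : fieldType) (A : subringClosed K) (p : maxSpec A).
Implicit Types (N M : set K).

Definition locmod M : set K :=
  [set x | exists m s, [/\ M m, s \in A, ~ p s & x = m / s]].

Lemma sub_locmod M : M `<=` locmod M.
Proof.
by move=> x Mx; exists x, 1; rewrite rpred1 divr1; split=> //; exact: compl1.
Qed.

Lemma locmod_sub M N : M `<=` N -> locmod M `<=` locmod N.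
Proof. by move=> MN _ [m [s [/MN Nm sA ps ->]]]; exists m, s. Qed.

Lemma sub_localization x : x \in A -> x \in localization p.
Proof.
by move=> xA; apply/asboolP; exists x, 1; rewrite rpred1 divr1; split=> //; exact: compl1.
Qed.

Lemma localizationV s : s \in A -> ~ p s -> s^-1 \in localization p.
Proof. by move=> sA ps; apply/asboolP; exists 1, s; rewrite rpred1 mul1r. Qed.

Lemma submod_locmod M : submodule A M -> submodule (localization p) (locmod M).
Proof.
move=> sM; split; first by apply: sub_locmod; exact: (submod0 sM).
move=> _ _ _ /asboolP[c [u [cA uA pu ->]]] [a [s [Ma sA ps ->]]]
    [b [t [Mb tA pt ->]]].
exists (c * t * a + u * s * b), (u * s * t).
split.
- by apply: (submodD sM); apply: (submodM sM) => //; rewrite rpredM.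
- by rewrite !rpredM.
- by apply: complM => //; [rewrite rpredM | exact: complM].
- by rewrite mulf_div addf_div ?mulf_neq0 ?(compl_neq0 (p := p))//; congr (_ / _); ring.
Qed.

Lemma locmod_ring : locmod [set` A] = [set` localization p].
Proof.
apply/seteqP; split=> [x [a [s [aA sA ps ->]]]|x /asboolP[a [s [aA sA ps ->]]]].
  by apply/asboolP; exists a, s.
by exists a, s.
Qed.

Lemma locmod_scale c M : locmod (scale c M) = scale c (locmod M).
Proof.
apply/seteqP; split=> [_ [_ [s [[m Mm <-] sA ps ->]]]|_ [_ [m [s [Mm sA ps ->]]] <-]].
  by exists (m / s); [exists m, s|rewrite mulrA].
by exists (c * m), s; rewrite mulrA; split=> //; exists m.
Qed.

(** A quotient killed by an element outside [p] vanishes at [p]. *)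
Lemma locmod_annihilated N M s : submodule A N -> N `<=` M -> s \in A -> ~ p s ->
  (forall m, M m -> N (s * m)) -> locmod N = locmod M.
Proof.
move=> sN NM sA ps sMN; apply/seteqP; split; first exact: locmod_sub.
move=> _ [m [t [Mm tA pt ->]]]; exists (s * m), (s * t).
split; [exact: sMN|exact: rpredM|exact: complM|].
by rewrite -mulf_div divff ?mul1r// (compl_neq0 ps).
Qed.

Lemma localization_unit c : c \in localization p ->
  localization_ideal p c \/ c^-1 \in localization p.
Proof.
move=> /asboolP[a [s [aA sA ps ->]]]; case: (pselect (p a)) => pa.
  by left; exists a, s.
by right; rewrite invf_div; apply/asboolP; exists s, a.
Qed.

Lemma common_denominator n (c : 'I_n -> K) : (forall i, c i \in localization p) ->
  exists s, [/\ s \in A, ~ p s & forall i, s * c i \in A].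
Proof.
elim: n c => [|n IH] c cA.
  by exists 1; rewrite rpred1; split=> //; [exact: compl1|case].
have [s [sA ps sc]] := IH (fun i => c (lift ord0 i)) (fun i => cA _).
have /asboolP[a [t [aA tA pt cE]]] := cA ord0.
exists (s * t); split; [exact: rpredM|exact: complM|move=> i].
case: (unliftP ord0 i) => [j ->|->].
  by rewrite mulrAC rpredM.
have -> : s * t * c ord0 = s * a by rewrite cE; field; exact: compl_neq0 pt.
by rewrite rpredM.
Qed.

End LocalizedModule.

Section LocalizedCover.
Variables (K : fieldType) (A B : subringClosed K) (AB : {subset A <= B}).
Variables (p : maxSpec A) (P : maxSpec B) (N M : set K).
Hypotheses (cNM : cover B N M) (PNM : annihilates P N M).
Hypothesis (pP : forall s, s \in A -> p s <-> P s).
Variables (n : nat) (e : 'I_n -> K).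
Hypothesis (eP : residue_basis A B P e).

(** [M / N] is isomorphic to [B / P], which is a vector space over [A / p] with
    basis [e]; the partial spans of the basis give a composition series. *)
Lemma length_localized_cover :
  has_length (localization p) (locmod p N) (locmod p M) n.
Proof.
have [sN sM [NM _] _] := cNM.
have [sNA sMA] := (submod_restrict AB sN, submod_restrict AB sM).
have [slN slM] := (submod_locmod p sNA, submod_locmod p sMA).
have [m Mm Nm] := cover_elt cNM.
have [eB e_span e_free] := eP.
have Me i : M (e i * m) by exact: (submodM sM).
pose F k : set K := [set x | exists y (c : 'I_n -> K),
  [/\ locmod p N y, (forall i, c i \in localization p),
      (forall i : 'I_n, (k <= i)%N -> c i = 0) &
      x = y + \sum_i c i * (e i * m)]].
have sF k : submodule (localization p) (F k).
  split.
    exists 0, (fun=> 0); split=> //; first exact: (submod0 slN).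
      by move=> _; exact: rpred0.
    by rewrite big1 ?addr0// => i _; rewrite mul0r.
  move=> a _ _ aA [y [c [Ny cA c0 ->]]] [z [d [Nz dA d0 ->]]].
  exists (a * y + z), (fun i => a * c i + d i); split.
  - by apply: (submodD slN) => //; exact: (submodM slN).
  - by move=> i; rewrite rpredD// rpredM.
  - by move=> i ki; rewrite c0// d0// mulr0 addr0.
  - rewrite mulrDr addrACA mulr_sumr -big_split/=; congr (_ + _).
    by apply: eq_bigr => i _; rewrite mulrDl mulrA.
have F0 : F 0%N = locmod p N.
  apply/seteqP; split.
    move=> _ [y [c [Ny _ c0 ->]]]; rewrite big1 ?addr0// => i _.
    by rewrite c0// mul0r.
  move=> y Ny; exists y, (fun=> 0); split=> //; first by move=> _; exact: rpred0.
  by rewrite big1 ?addr0// => i _; rewrite mul0r.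
have Fn : F n = locmod p M.
  apply/seteqP; split.
    move=> _ [y [c [Ny cA _ ->]]]; apply: (submodD slM); first exact: (locmod_sub NM).
    apply: (submod_sum _ slM) => i; apply: (submodM slM) => //.
    exact: sub_locmod.
  move=> _ [z [s [Mz sA ps ->]]].
  have [x [b [Nx bB zE]]] := cover_gen cNM Mm Nm Mz.
  have [c cA Pc] := e_span b bB.
  exists ((x + (b - \sum_i c i * e i) * m) / s), (fun i => c i / s); split.
  - exists (x + (b - \sum_i c i * e i) * m), s; split=> //.
    by apply: (submodD sN) => //; exact: PNM.
  - by move=> i; rewrite rpredM ?localizationV ?sub_localization.
  - by move=> i; rewrite leqNgt ltn_ord.
  - have -> : \sum_i c i / s * (e i * m) = (\sum_i c i * e i) * m / s.
      by rewrite mulr_suml mulr_suml; apply: eq_bigr => i _; ring.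
    by rewrite -mulrDl zE; congr (_ / _); ring.
have Fsub k : F k `<=` F k.+1.
  move=> _ [y [c [Ny cA c0 ->]]]; exists y, c; split=> // i ki.
  by apply: c0; exact: ltnW.
have em_mem (k : 'I_n) : F k.+1 (e k * m).
  exists 0, (fun i => (i == k)%:R); split; first exact: (submod0 slN).
  - by move=> i; exact: rpred_nat.
  - by move=> i ki; case: eqP ki => // ->; rewrite ltnn.
  - rewrite (bigD1 k)//= eqxx mul1r big1 ?addr0 ?add0r// => i /negbTE ->.
    by rewrite mul0r.
have em_notin (k : 'I_n) : ~ F k (e k * m).
  move=> [_ [c [[y [s [Ny sA ps ->]]] cA c0 ekE]]].
  (* Clearing denominators turns the relation into one between the e i modulo P
     whose k-th coefficient is t * s, outside p. *)
  have [t [tA pt tc]] := common_denominator cA.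
  pose d i := t * s * ((i == k)%:R - c i).
  have dA i : d i \in A.
    have -> : d i = t * s * (i == k)%:R - s * (t * c i) by rewrite /d; ring.
    have ikA : ((i == k)%:R : K) \in A by case: (i == k); rewrite ?rpred0 ?rpred1.
    by apply: rpredB; apply: rpredM => //; exact: rpredM.
  have dk : d k = t * s by rewrite /d eqxx c0// subr0 mulr1.
  have : P (d k).
    apply: e_free => //.
    apply: (annihilates_ideal sN PNM Mm Nm).
      by apply: rpred_sum => i _; apply: rpredM => //; exact: AB.
    have -> : (\sum_i d i * e i) * m = t * y; last exact: (submodM sN (AB tA) Ny).
    transitivity (t * s * (e k * m - \sum_i c i * (e i * m))).
      rewrite mulrBr mulr_sumr (bigD1 k)//= [in RHS](bigD1 k)//= dk.
      rewrite (c0 k)// mul0r mulr0 add0r mulrDl -mulrA; congr (_ + _).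
      rewrite -sumrN mulr_suml; apply: eq_bigr => i /negbTE ik.
      by rewrite /d ik sub0r; ring.
    by rewrite ekE addrK; field; exact: compl_neq0 ps.
  have tsA : t * s \in A by exact: rpredM.
  by rewrite dk => /(pP tsA); exact: complM.
suff H k : (k <= n)%N -> has_length (localization p) (locmod p N) (F k) k.
  by rewrite -Fn; exact: H.
elim: k => [_|k IH kn]; first by rewrite F0; exact: has_length0.
apply: has_lengthS; first exact/IH/ltnW.
pose k' := Ordinal kn.
split=> //.
  split; first exact: Fsub.
  by move=> /(_ _ (em_mem k')); exact: (em_notin k').
have peel x : F k.+1 x ->
    exists2 a, a \in localization p & F k (x - a * (e k' * m)).
  move=> [y [c [Ny cA c0 ->]]]; exists (c k') => //.
  exists y, (fun i => if i == k' then 0 else c i); split=> //.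
  - by move=> i; case: ifP => // _; exact: rpred0.
  - move=> i ki; case: eqP => // /eqP ik; apply: c0.
    by rewrite ltn_neqAle ki andbT eq_sym.
  - rewrite (bigD1 k')//= [in RHS](bigD1 k')//= eqxx mul0r add0r.
    rewrite [c k' * _ + _]addrC addrA addrK.
    by congr (_ + _); apply: eq_bigr => i /negbTE ->.
move=> L sL FL LF; case: (pselect (L `<=` F k)) => LFk.
  by left; apply/seteqP.
right; apply/seteqP; split=> //.
suff Lek : L (e k' * m).
  move=> x /peel[a aA Fx]; rewrite -(subrK (a * (e k' * m)) x).
  by apply: (submodD sL); [exact: FL | exact: (submodM sL)].
have [l Ll Fl] : exists2 l, L l & ~ F k l.
  apply: contrapT => h; apply: LFk => l Ll; apply: contrapT => Fl.
  by apply: h; exists l.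
have [c cA Frest] := peel _ (LF _ Ll).
have Lck : L (c * (e k' * m)).
  have -> : c * (e k' * m) = l - (l - c * (e k' * m)) by rewrite opprB addrC subrK.
  by apply: (submodB sL) => //; exact: FL.
(* A coefficient in the maximal ideal kills e k' * m modulo N. *)
have [[a [s [pa sA ps cE]]]|cV] := localization_unit cA.
  exfalso; apply: Fl; rewrite -(subrK (c * (e k' * m)) l).
  apply: (submodD (sF k)) => //.
  have : locmod p N (c * (e k' * m)).
    exists (a * (e k' * m)), s; split=> //; last by rewrite cE mulrAC.
    by apply: PNM => //; apply/pP => //; exact: maxSpec_sub pa.
  by rewrite -F0; elim: (k) => // j IHj /IHj; exact: Fsub.
case: (eqVneq c 0) => [c0|c0].
  by exfalso; apply: Fl; rewrite -[l]subr0 -(mul0r (e k' * m)) -c0.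
by rewrite -(mulKf c0 (e k' * m)); exact: (submodM sL).
Qed.

End LocalizedCover.

Section Factors.
Variables (K : fieldType) (B : subringClosed K).
Implicit Types (N M : set K).

(** The annihilators of the simple quotients are recorded, and not just their
    number, because localizing at a maximal ideal keeps only some of them. *)
Inductive factors N : set K -> seq (maxSpec B) -> Prop :=
| factors0 : submodule B N -> factors N N [::]
| factorsS M M' (P : maxSpec B) s : factors N M s -> cover B M M' -> annihilates P M M' ->
    factors N M' (P :: s).

Lemma has_length_factors N M n : has_length B N M n -> exists s, factors N M s.
Proof.
move=> h; elim: h => [sN|X Y m _ [s hs] cXY]; first by exists [::]; exact: factors0.
by have [P hP] := cover_annihilator cXY; exists (P :: s); exact: factorsS hs cXY hP.
Qed.

(** The common source of all formulas for orders. Of the factors [B / P], those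
    with [P] over [p] (selected by [c]) contribute their degree over [A / p] and
    the others vanish. It is used with [B = A], where the degrees are one, and with
    [B] the normalization of [A]. *)
Lemma factors_localized (A : subringClosed K) (p : maxSpec A)
    (c : pred (maxSpec B)) (w : maxSpec B -> nat) N M s :
  {subset A <= B} -> factors N M s ->
  (forall P, c P -> forall a, a \in A -> p a <-> P a) ->
  (forall P, ~~ c P -> exists a, [/\ a \in A, P a & ~ p a]) ->
  (forall P, c P -> exists e : 'I_(w P) -> K, residue_basis A B P e) ->
  has_length (localization p) (locmod p N) (locmod p M) (\sum_(P <- s | c P) w P).
Proof.
move=> AB h above off basis; elim: h => [sN|X Y P s' _ IH cXY PXY].
  rewrite big_nil; apply: has_length0; apply: submod_locmod.
  exact: submod_restrict AB sN.
rewrite big_cons; case: (boolP (c P)) => cP.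
  have [e eP] := basis _ cP; rewrite addnC; apply: has_length_trans IH _.
  exact: (length_localized_cover AB cXY PXY (above _ cP) eP).
have [a [aA Pa pa]] := off _ cP; have [sX _ [XY _] _] := cXY.
rewrite -(locmod_annihilated (submod_restrict AB sX) XY aA pa)//.
by move=> m Ym; exact: PXY.
Qed.

End Factors.

Lemma maxSpec_ext (K : fieldType) (A : subringClosed K) (p q : maxSpec A) :
  (forall x, p x -> q x) -> p = q.
Proof.
move=> pq; apply: val_inj => /=; apply/esym.
have [_ _ pmax] := maxSpecP p; have [qI q1 _] := maxSpecP q.
exact: pmax.
Qed.

Lemma maxSpec_neq (K : fieldType) (A : subringClosed K) (p q : maxSpec A) :
  p != q -> exists a, [/\ a \in A, p a & ~ q a].
Proof.
move=> /eqP pq; apply: contrapT => h; apply: pq; apply: maxSpec_ext => x px.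
apply: contrapT => qx; apply: h; exists x; split=> //.
exact: maxSpec_sub px.
Qed.

(** * Orders and divisors *)

Section Order.
Variables (K : fieldType) (A : subringClosed K).

(** Over such a ring the lengths that define [ord] are finite, so that [ord] and
    [div] are homomorphisms; it holds for the base ring, its normalization and
    its localizations. *)
Definition finite_colength : Prop := forall a, a \in A -> a != 0 ->
  exists n, has_length A (scale a [set` A]) [set` A] n.

Lemma scale_ring_sub a : a \in A -> scale a [set` A] `<=` [set` A].
Proof. by move=> aA _ [x xA <-] /=; rewrite rpredM. Qed.

Lemma residue_basis_self (P : maxSpec A) :
  exists e : 'I_1 -> K, residue_basis A A P e.
Proof.
exists (fun=> 1); split.
- by move=> _; exact: rpred1.
- move=> x xA; exists (fun=> x) => //; rewrite big_ord1 mulr1 subrr.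
  exact: maxSpec0.
- by move=> c _; rewrite big_ord1 mulr1 => Pc i; rewrite ord1.
Qed.

Lemma loc_length_count a s (p : maxSpec A) : factors (scale a [set` A]) [set` A] s ->
  has_length (localization p) (scale a [set` localization p])
    [set` localization p] (count_mem p s).
Proof.
move=> hs; rewrite -locmod_ring -locmod_scale -sum1_count.
apply: (factors_localized (w := fun=> 1%N) _ hs) => //.
- by move=> P /eqP ->.
- by move=> P; exact: maxSpec_neq.
- by move=> P _; exact: residue_basis_self.
Qed.

Hypothesis A_fin : finite_colength.
Implicit Type p : maxSpec A.

Lemma loc_lengthE a s p : factors (scale a [set` A]) [set` A] s ->
  loc_length p a = count_mem p s.
Proof. by move=> hs; apply: length_quotE; exact: loc_length_count. Qed.

Lemma finite_colength_factors a : a \in A -> a != 0 ->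
  exists s : seq (maxSpec A), factors (scale a [set` A]) [set` A] s.
Proof. by move=> aA a0; have [n /has_length_factors] := A_fin aA a0. Qed.

Lemma loc_length_spec a p : a \in A -> a != 0 ->
  has_length (localization p) (scale a [set` localization p])
    [set` localization p] (loc_length p a).
Proof.
move=> aA a0; have [s hs] := finite_colength_factors aA a0.
by rewrite (loc_lengthE p hs); exact: loc_length_count.
Qed.

Lemma loc_lengthM a b p : a \in A -> b \in A -> a != 0 -> b != 0 ->
  loc_length p (a * b) = (loc_length p a + loc_length p b)%N.
Proof.
move=> aA bA a0 b0; apply: length_quotE; rewrite addnC.
apply: has_length_trans (loc_length_spec p aA a0).
change (has_length (localization p) (scale (a * b) [set` localization p])
  (scale a [set` localization p]) (loc_length p b)).
by rewrite scaleA; apply: has_length_scale => //; exact: loc_length_spec.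
Qed.

(** The value does not depend on the fraction, by additivity of lengths. *)
Lemma ord_frac a b p : a \in A -> b \in A -> a != 0 -> b != 0 ->
  ord p (a / b) = (loc_length p a)%:Z - (loc_length p b)%:Z.
Proof.
move=> aA bA a0 b0; apply: xget_unique; first by exists a, b.
move=> _ [a' [b' [[a'A b'A] a'0 b'0 e ->]]].
have /(congr1 (fun x => (loc_length p x)%:Z)) : a' * b = a * b'.
  by apply/eqP; rewrite -eqr_div// e.
by rewrite !loc_lengthM// !PoszD => h; apply/eqP; rewrite subr_eq addrAC -h addrK.
Qed.

Lemma ord_int a p : a \in A -> a != 0 -> ord p a = (loc_length p a)%:Z.
Proof.
move=> aA a0; rewrite -{1}[a]divr1 ord_frac ?rpred1 ?oner_neq0//.
have : loc_length p 1 = (loc_length p 1 + loc_length p 1)%N.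
  by rewrite -loc_lengthM ?mulr1 ?rpred1 ?oner_neq0.
by move=> h; have -> : loc_length p 1 = 0%N; [lia|rewrite subr0].
Qed.

Hypothesis A_frac : fraction_field A.

Lemma fracP x : x != 0 ->
  exists a b, [/\ a \in A /\ b \in A, a != 0, b != 0 & x = a / b].
Proof.
have [a [b [aA bA b0 ->]]] := A_frac x.
by rewrite mulf_eq0 negb_or => /andP[a0 _]; exists a, b.
Qed.

Lemma ordM x y p : x != 0 -> y != 0 -> ord p (x * y) = ord p x + ord p y.
Proof.
move=> /fracP[a [b [[aA bA] a0 b0 ->]]] /fracP[c [d [[cA dA] c0 d0 ->]]].
rewrite mulf_div !ord_frac ?mulf_neq0 ?rpredM// !loc_lengthM// !PoszD.
by lia.
Qed.

(** A divisor with the orders of [x] as coefficients witnesses that only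
    finitely many of them are nonzero, so the sum defining [div] is genuine. *)
Lemma div_eq x (D : Div A) : (forall p, coeff p D = ord p x) -> div A x = D.
Proof.
move=> DE; rewrite /div (fsbigE (dom D)) ?uniq_dom//.
  rewrite -[RHS]freeg_sumE; apply: eq_big => [p|p _]; first by rewrite in_setT.
  by rewrite DE.
by move=> p _; rewrite mem_dom negbK DE => /eqP ->; rewrite freegU0.
Qed.

Lemma coeff_sum_points (s : seq (maxSpec A)) p :
  coeff p (\sum_(q <- s) (<< q >> : Div A)) = (count_mem p s)%:Z.
Proof.
elim: s => [|q s IH]; first by rewrite big_nil coeff0.
by rewrite big_cons coeffD IH coeffU mul1r /= PoszD; case: (q == p).
Qed.

Lemma div_factors a s : a \in A -> a != 0 ->
  factors (scale a [set` A]) [set` A] s -> div A a = \sum_(q <- s) << q >>.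
Proof.
move=> aA a0 hs; apply: div_eq => p.
by rewrite coeff_sum_points ord_int// (loc_lengthE p hs).
Qed.

Lemma coeff_div_int a p : a \in A -> a != 0 -> coeff p (div A a) = ord p a.
Proof.
move=> aA a0; have [s hs] := finite_colength_factors aA a0.
by rewrite (div_factors aA a0 hs) coeff_sum_points ord_int// (loc_lengthE p hs).
Qed.

Lemma div_frac a b : a \in A -> b \in A -> a != 0 -> b != 0 ->
  div A (a / b) = div A a - div A b.
Proof.
move=> aA bA a0 b0; apply: div_eq => p.
by rewrite coeffB !coeff_div_int// ord_frac// !ord_int.
Qed.

Lemma coeff_div x p : x != 0 -> coeff p (div A x) = ord p x.
Proof.
move=> /fracP[a [b [[aA bA] a0 b0 ->]]].
by rewrite div_frac// coeffB !coeff_div_int// ord_frac// !ord_int.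
Qed.

Lemma divM x y : x != 0 -> y != 0 -> div A (x * y) = div A x + div A y.
Proof.
by move=> x0 y0; apply: div_eq => p; rewrite coeffD !coeff_div// ordM.
Qed.

Lemma div1 : div A 1 = 0.
Proof.
by apply: (addrI (div A 1)); rewrite -divM ?oner_neq0// mulr1 addr0.
Qed.

Lemma ordV x p : x != 0 -> ord p x^-1 = - ord p x.
Proof.
move=> x0; have : ord p (x^-1 * x) = 0.
  by rewrite mulVf// -coeff_div ?oner_neq0// div1 coeff0.
by rewrite ordM ?invr_eq0// => /eqP; rewrite addr_eq0 => /eqP.
Qed.

Lemma principal_zmod_closed : zmod_closed (fun D => `[< principal_divisors (A := A) D >]).
Proof.
split; first by apply/asboolP; exists 1; rewrite ?oner_neq0// div1.
move=> _ _ /asboolP[x x0 ->] /asboolP[y y0 ->]; apply/asboolP; exists (x / y).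
  by rewrite mulf_neq0 ?invr_eq0.
apply/eqP; rewrite subr_eq -divM ?mulf_neq0 ?invr_eq0//.
by rewrite mulfVK.
Qed.

Lemma divisor_class_eq0 D : divisor_class A D = 0 <-> principal_divisors D.
Proof. exact: quot_class_eq0 principal_zmod_closed D. Qed.

Lemma ord_eq0 a p : a \in A -> ~ p a -> ord p a = 0.
Proof.
move=> aA pa; have a0 : a != 0 := compl_neq0 pa.
rewrite ord_int//; congr Posz; apply: length_quotE.
suff -> : principal_ideal (localization p) a = [set` localization p].
  by apply: has_length0; exact: submod_ring.
apply/seteqP; split=> [_ [x xA <-]|x xA]; first by rewrite /= rpredM// sub_localization.
exists (a^-1 * x); last by rewrite mulVKf.
by rewrite /= rpredM// localizationV.
Qed.

End Order.

(** * Finite length in dimension one *)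

Section Noetherian.
Variables (K : fieldType) (A : subringClosed K).
Hypothesis A_noeth : noetherian A.

(** Zorn's lemma applies because the union of a chain of ideals is finitely
    generated, hence equal to a member containing the generators. *)
Lemma noetherian_maximal (Phi : set K -> Prop) I0 :
  (forall I, Phi I -> ideal A I) -> Phi I0 ->
  exists I, [/\ Phi I, I0 `<=` I & forall J, Phi J -> I `<=` J -> J = I].
Proof.
move=> Phi_ideal Phi0.
(* The empty set is admitted because it is the union of the empty chain. *)
pose Q : set (set K) := [set X | X = set0 \/ (Phi X /\ I0 `<=` X)].
have I0_0 : I0 0 by have [[]] := Phi_ideal _ Phi0.
have [I [QI Imax]] : exists I, Q I /\ forall J, I `<` J -> ~ Q J.
  apply: Zorn_bigcup => F FQ Ftot.
  case: (pselect (exists2 X, F X & X 0)) => [[X0 FX0 X00]|no0]; last first.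
    left; rewrite -subset0 => x [X FX Xx]; apply: no0.
    by exists X => //; case: (FQ _ FX) Xx => [->//|[_ IX] _]; exact: IX.
  right; set U := \bigcup_(X in F) X.
  have mem_Phi X x : F X -> X x -> Phi X /\ I0 `<=` X.
    by move=> FX Xx; case: (FQ _ FX) Xx => [->|].
  have absorb n (e : 'I_n -> K) : (forall i, U (e i)) ->
      exists X, [/\ F X, X 0 & forall i, X (e i)].
    elim: n e => [|n IH] e Ue; first by exists X0; split=> //; case.
    have [X [FX X_0 Xe]] := IH (fun i => e (lift ord0 i)) (fun i => Ue _).
    have [Y FY Ye] := Ue ord0.
    case: (Ftot X Y FX FY) => [XY|YX].
      exists Y; split=> //; first exact: XY.
      by move=> i; case: (unliftP ord0 i) => [j ->|->] //; exact: XY.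
    exists X; split=> // i; case: (unliftP ord0 i) => [j ->|->] //; exact: YX.
  have U_ideal : ideal A U.
    split; first split.
    - by exists X0.
    - move=> a x y aA Ux Uy; pose e (i : 'I_2) := if i == ord0 then x else y.
      have [|X [FX X_0 Xe]] := absorb _ e; first by move=> i; rewrite /e; case: ifP.
      have [PX _] := mem_Phi _ _ FX X_0; have [[_ hX] _] := Phi_ideal _ PX.
      by exists X => //; apply: hX => //; [have := Xe ord0 | have := Xe (lift ord0 ord0)].
    - move=> x [X FX Xx]; have [PX _] := mem_Phi _ _ FX Xx.
      by have [_] := Phi_ideal _ PX; apply.
  have [n [e UE]] := A_noeth U_ideal.
  have [|X [FX X_0 Xe]] := absorb _ e.
    move=> i; rewrite UE; exists (fun j => (j == i)%:R).
      by move=> j; case: (j == i); rewrite ?rpred0 ?rpred1.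
    by rewrite (bigD1 i)//= eqxx mul1r big1 ?addr0// => j /negbTE ->; rewrite mul0r.
  have [PX IX] := mem_Phi _ _ FX X_0.
  suff -> : U = X by [].
  apply/seteqP; split=> [x|x Xx]; last by exists X.
  rewrite UE => -[c cA ->]; have [sX _] := Phi_ideal _ PX.
  by apply: (submod_sum _ sX) => i; exact: (submodM sX).
have I_0 : I 0.
  apply: contrapT => nI0; apply: (Imax I0); last by right; split.
  case: QI => [->|[PI]]; first by split=> // h; exact: (h 0).
  by move=> /(_ _ I0_0).
case: QI => [IE|[PI II]]; first by rewrite IE in I_0.
exists I; split=> // J PJ IJ; apply: contrapT => nJI; apply: (Imax J).
  by split=> // JI; apply: nJI; apply/seteqP.
by right; split=> //; exact: subset_trans II IJ.
Qed.

Lemma maximal_prime (p : maxSpec A) : prime_ideal A p.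
Proof.
by have [pI p1 _] := maxSpecP p; split=> // x y xA yA; exact: maxSpec_prime.
Qed.

Lemma sub_maximal I : ideal A I -> ~ I 1 -> exists p : maxSpec A, I `<=` p.
Proof.
move=> iI I1.
have [||m [[im m1] Im mmax]] := noetherian_maximal (Phi := fun J => ideal A J /\ ~ J 1)
    (I0 := I); [by move=> J []|by []|].
have mP : maximal_ideal A m by split=> // J iJ J1 mJ; exact: mmax.
by exists (MaxSpec (asboolT mP)).
Qed.

Hypothesis A_dim : krull_dim A 1.

Lemma zero_prime : prime_ideal A [set 0].
Proof.
split; first split; first split=> //.
- by move=> a x y _ /= -> ->; rewrite mulr0 addr0.
- by move=> _ /= ->; exact: rpred0.
- by move=> /eqP; rewrite oner_eq0.
- by move=> x y _ _ /eqP; rewrite mulf_eq0 => /orP[]/eqP; [left|right].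
Qed.

(** If [I] were properly contained in an ideal [J], then [0], [I] and a maximal
    ideal containing [J] would form a chain of length two. *)
Lemma dim1_prime_maximal I x : prime_ideal A I -> I x -> x != 0 -> maximal_ideal A I.
Proof.
move=> pI Ix x0; have [iI I1 _] := pI; split=> // J iJ J1 IJ.
apply: contrapT => JI; have [m Jm] := sub_maximal iJ J1.
case: A_dim => _; apply.
exists (fun i => if i is 0 then [set 0] else if i is 1 then I else m); split.
  by move=> [|[|i]] _; [exact: zero_prime|exact: pI|exact: maximal_prime].
move=> [|[|i]] //= _; split.
- by move=> _ ->; have [[]] := iI.
- by move=> /(_ _ Ix) /eqP; rewrite (negbTE x0).
- exact: subset_trans IJ Jm.
- by move=> mI; apply: JI; apply/seteqP; split=> // z /Jm/mI.
Qed.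

(** Otherwise [0] would be maximal and there would be no chain of two primes. *)
Lemma maxSpec_neq0 (p : maxSpec A) : exists2 x, p x & x != 0.
Proof.
apply: contrapT => h.
have p0 x : p x -> x = 0.
  by move=> px; apply/eqP; apply: contrapT => /negP x0; apply: h; exists x.
case: A_dim => -[P [Pprime Pchain]] _.
have [[[P00 _] _] _ _] := Pprime 0%N isT; have [iP1 P11 _] := Pprime 1%N isT.
have [P01 nP10] := Pchain 0%N isT; apply: nP10.
have [_ _ pmax] := maxSpecP p.
have P1E : P 1%N = p by apply: pmax => // x /p0 ->; exact: P01.
by move=> x; rewrite P1E => /p0 ->.
Qed.

Lemma maximal_cover (p : maxSpec A) : cover A p [set` A].
Proof.
have [[sp pA] p1 pmax] := maxSpecP p; split=> //; first exact: submod_ring.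
  by split=> // /(_ 1); apply: contra_not p1; apply; exact: rpred1.
move=> L sL pL LA; case: (pselect (L 1)) => L1; last by left; apply: pmax.
right; apply/seteqP; split=> // x xA; rewrite -[x]mulr1; exact: (submodM sL).
Qed.

(** Among the ideals containing [a] whose quotient has infinite length, a maximal
    one would be prime: if [x * y] is in [I] but neither [x] nor [y] is, then
    [A / (I + x A)] and [(I + x A) / I], which is isomorphic to [A / (I : x)],
    have finite length. In dimension one it would then be a maximal ideal, whose
    quotient has length one. *)
Lemma dim1_finite_colength : finite_colength A.
Proof.
move=> a aA a0; apply: contrapT => inf.
pose Phi I := [/\ ideal A I, I a & ~ exists n, has_length A I [set` A] n].
have [||I [[iI Ia infI] _ Imax]] := noetherian_maximal (Phi := Phi)
    (I0 := scale a [set` A]).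
- by move=> I [].
- split=> //; last by exists 1; rewrite ?mulr1//= rpred1.
  by split; [exact/submod_scale/submod_ring|exact: scale_ring_sub].
have [sI IA] := iI.
have bigger J : ideal A J -> I `<=` J -> J <> I -> exists n, has_length A J [set` A] n.
  move=> iJ IJ JI; apply: contrapT => infJ; apply: JI; apply: Imax => //.
  by split=> //; exact: IJ.
have I1 : ~ I 1.
  move=> I1; apply: infI; exists 0%N.
  have -> : I = [set` A]; last by apply: has_length0; exact: submod_ring.
  by apply/seteqP; split=> // x xA; rewrite -[x]mulr1; exact: (submodM sI).
have nprime : ~ prime_ideal A I.
  move=> pI; apply: infI; exists 1%N.
  have mI := dim1_prime_maximal pI Ia a0.
  exact/cover_length/(maximal_cover (MaxSpec (asboolT mI))).
apply: nprime; split=> // x y xA yA Ixy; apply: contrapT => /not_orP[Ix Iy].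
have x0 : x != 0 by apply: contra_notN Ix => /eqP ->; exact: (submod0 sI).
pose I1x := msum (scale x [set` A]) I.
pose Icx : set K := [set z | z \in A /\ I (x * z)].
have sxA : submodule A (scale x [set` A]) by exact/submod_scale/submod_ring.
have [|||n1 h1] := bigger I1x.
- split; first exact: submod_msum.
  by apply: msum_sub => //; [exact: submod_ring|exact: scale_ring_sub].
- exact: (msumR sxA).
- move=> e; apply: Ix; rewrite -e; apply: (msumL sI).
  by exists 1; rewrite ?mulr1//= rpred1.
have [|||n2 h2] := bigger Icx.
- split; last by move=> z [].
  split; first by split; [exact: rpred0|rewrite mulr0; exact: (submod0 sI)].
  move=> b z w bA [zA Iz] [wA Iw]; split; first by rewrite rpredD// rpredM.
  by rewrite mulrDr mulrCA; apply: (submodD sI) => //; exact: (submodM sI).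
- by move=> z Iz; split; [exact: IA|exact: (submodM sI)].
- by move=> e; apply: Iy; rewrite -e.
apply: infI; exists (n2 + n1)%N; apply: has_length_trans h1.
have := has_length_addr sI (has_length_scale x0 h2).
have -> : msum (scale x Icx) I = I.
  apply/seteqP; split; last first.
    by apply: msumR; exact/submod_scale/(has_length_submodl h2).
  by apply: (msum_sub sI) => // _ [z [zA Iz] <-].
by apply=> _ [[z zA <-] Iz]; exists z.
Qed.

End Noetherian.

(** * Finite extensions and local rings *)

Section FiniteExtension.
Variables (K : fieldType) (A B : subringClosed K) (AB : {subset A <= B}).
Hypotheses (A_frac : fraction_field A) (A_fin : finite_colength A).
Hypothesis B_fg : finitely_generated A [set` B].

(** The product of the denominators of finitely many generators. *)
Lemma conductor : exists d, [/\ d \in A, d != 0 & forall x, x \in B -> d * x \in A].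
Proof.
have [n [e BE]] := B_fg.
have [d [dA d0 de]] : exists d, [/\ d \in A, d != 0 & forall i, d * e i \in A].
  elim: n e {BE} => [|n IH] e; first by exists 1; rewrite rpred1 oner_eq0; split=> //; case.
  have [d [dA d0 de]] := IH (fun i => e (lift ord0 i)).
  have [a [b [aA bA b0 eE]]] := A_frac (e ord0).
  exists (d * b); rewrite rpredM// mulf_neq0//; split=> // i.
  case: (unliftP ord0 i) => [j ->|->]; first by rewrite mulrAC rpredM.
  have -> : d * b * e ord0 = d * a by rewrite eE; field.
  by rewrite rpredM.
exists d; split=> // x xB; have : [set` B] x by [].
rewrite BE => -[c cA ->]; rewrite mulr_sumr rpred_sum// => i _.
by rewrite mulrCA rpredM.
Qed.

Let sB : submodule A [set` B] := submod_restrict AB (submod_ring B).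

(** If [d] carries [B] into [A], multiplication by [d] identifies [B / A] with
    [d B / d A], which lies in [A / d A]. *)
Lemma finite_length_extension : exists n, has_length A [set` A] [set` B] n.
Proof.
have [d [dA d0 dB]] := conductor; have [n h] := A_fin dA d0.
have [||n1 [n2 [h1 _ _]]] := has_length_between h (submod_scale d sB).
- exact: scale_sub.
- by move=> _ [x xB <-]; exact: dB.
exists n1; have := has_length_scale (c := d^-1) _ h1.
by rewrite !scaleK// invr_eq0; apply.
Qed.

(** A nonzero [a] divides a nonzero [u] in [A], and [a B] lies between [u A]
    and [B], which has finite length over [u A]. *)
Lemma finite_colength_extension : finite_colength B.
Proof.
move=> a aB a0.
suff [n hn] : exists n, has_length A (scale a [set` B]) [set` B] n.
  by apply: (has_length_extend AB) hn; [exact/submod_scale/submod_ring|exact: submod_ring].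
have [u [v [uA vA v0 aE]]] := A_frac a.
have uE : u = a * v by rewrite aE; field.
have u0 : u != 0 by rewrite uE mulf_neq0.
have [n1 h1] := A_fin uA u0; have [n2 h2] := finite_length_extension.
have uB : submodule A (scale u [set` B]) by exact: submod_scale.
have aBs : submodule A (scale a [set` B]) by exact: submod_scale.
have [||m3 [n3 [_ h3 _]]] := has_length_between (has_length_trans h1 h2) uB.
- exact: scale_sub.
- by move=> _ [x xB <-]; apply: rpredM => //; exact: AB.
have [||m4 [n4 [_ h4 _]]] := has_length_between h3 aBs; last by exists n4.
  by move=> _ [x xB <-]; exists (v * x); [apply: rpredM => //; exact: AB | rewrite uE mulrA].
exact: scale_ring_sub.
Qed.

(** A generating family of [B / P] of least cardinality is a basis: in a
    nontrivial relation some coefficient is invertible modulo [P], so one member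
    is redundant. *)
Lemma residue_basis_exists (P : maxSpec B) :
  (forall c, c \in A -> ~ P c -> exists2 y, y \in A & P (c * y - 1)) ->
  exists n (e : 'I_n -> K), residue_basis A B P e.
Proof.
move=> P_inv; have sP : submodule B P by have [[]] := maxSpecP P.
pose gen n := `[< exists e : 'I_n -> K, (forall i, e i \in B) /\
  forall x, x \in B -> exists2 c : 'I_n -> K,
     (forall i, c i \in A) & P (x - \sum_i c i * e i) >].
have : exists n, gen n.
  have [n [e BE]] := B_fg; exists n; apply/asboolP; exists e; split.
    move=> i; suff : [set` B] (e i) by [].
    rewrite BE; exists (fun j => (j == i)%:R).
      by move=> j; case: (j == i); rewrite ?rpred0 ?rpred1.
    by rewrite (bigD1 i)//= eqxx mul1r big1 ?addr0// => j /negbTE ->; rewrite mul0r.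
  move=> x xB; have : [set` B] x by [].
  by rewrite BE => -[c cA ->]; exists c => //; rewrite subrr; exact: maxSpec0.
move=> ex; case: (ex_minnP ex) => n /asboolP[e [eB e_span]] nmin.
exists n, e; split=> // c cA Pc i; apply: contrapT => Pci.
have [y yA Py] := P_inv _ (cA i) Pci.
case: n i e eB e_span nmin c cA Pc Pci Py => [[]//|n] i e eB e_span nmin c cA Pc Pci Py.
suff /nmin : gen n by rewrite ltnn.
apply/asboolP; exists (fun j => e (lift i j)); split=> // x xB.
have [d dA Pd] := e_span x xB.
exists (fun j => d (lift i j) - d i * y * c (lift i j)).
  by move=> j; rewrite rpredB// !rpredM.
(* The term c i * y - 1 lies in P, so e i can be eliminated. *)
have -> : x - \sum_j (d (lift i j) - d i * y * c (lift i j)) * e (lift i j) =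
    (x - \sum_j d j * e j) + (d i * y * (\sum_j c j * e j)
      - d i * e i * (c i * y - 1)).
  rewrite (bigD1_ord i)//= [\sum_j c j * e j](bigD1_ord i)//=.
  under eq_bigr do rewrite mulrBl -!mulrA.
  rewrite sumrB -!mulr_sumr; ring.
apply: (submodD sP) => //; apply: (submodB sP).
  by apply: (submodM sP) => //; apply: rpredM; exact: AB.
by apply: (submodM sP) => //; apply: rpredM => //; exact: AB.
Qed.

End FiniteExtension.

Section LocalRing.
Variables (K : fieldType) (A : subringClosed K) (p : maxSpec A).
Hypotheses (A_frac : fraction_field A) (A_fin : finite_colength A).
Local Notation Ap := (localization p).

Lemma localization_frac : fraction_field Ap.
Proof.
move=> x; have [a [b [aA bA b0 ->]]] := A_frac x.
by exists a, b; rewrite !sub_localization.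
Qed.

Lemma localization_finite_colength : finite_colength Ap.
Proof.
move=> _ /asboolP[a [s [aA sA ps ->]]] as0.
have a0 : a != 0 by apply: contraNneq as0 => ->; rewrite mul0r.
exists (loc_length p a); have := loc_length_spec A_fin p aA a0.
congr (has_length _ _ _ _); apply/seteqP; split=> _ [x xA <-].
  exists (s * x); first by rewrite /= rpredM// sub_localization.
  by field; exact: compl_neq0 ps.
exists (s^-1 * x); first by rewrite /= rpredM// localizationV.
by field; exact: compl_neq0 ps.
Qed.

Lemma loc_max_unique (q : maxSpec Ap) : q = loc_max p.
Proof.
apply: maxSpec_ext => x qx /=.
case: (eqVneq x 0) => [->|x0]; first exact: (maxSpec0 (loc_max p)).
have [//|xV] := localization_unit (maxSpec_sub qx).
exfalso; have [[sq _] q1 _] := maxSpecP q; apply: q1.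
by rewrite -(mulVf x0); exact: (submodM sq).
Qed.

(** Localizing a local ring changes nothing. *)
Lemma localization_loc_max : localization (loc_max p) = Ap :> {pred K}.
Proof.
apply/funext => x; apply/idP/idP => [/asboolP[a [s [aA sA ps ->]]]|xA].
  have [//|sV] := localization_unit sA; exact: rpredM.
exact: sub_localization.
Qed.

Lemma ord_loc_max x : x != 0 -> ord (loc_max p) x = ord p x.
Proof.
move=> /(fracP A_frac)[a [b [[aA bA] a0 b0 ->]]].
rewrite (ord_frac A_fin)// (ord_frac localization_finite_colength) ?sub_localization//.
by rewrite /loc_length localization_loc_max.
Qed.

End LocalRing.

(** * Uniformizers and weak approximation *)

Section Uniformizer.
Variables (K : fieldType) (A : subringClosed K) (p : maxSpec A).

Lemma localization_ideal_inv x : x \in A -> localization_ideal p x -> p x.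
Proof.
move=> xA [a [s [pa sA ps xE]]].
have : p (x * s) by rewrite xE mulfVK ?(compl_neq0 ps).
by case/(maxSpec_prime xA sA).
Qed.

Lemma sub_localization_ideal x : p x -> localization_ideal p x.
Proof. by move=> px; exists x, 1; rewrite rpred1 divr1; split=> //; exact: compl1. Qed.

(** An element of [p] itself, and not only of the localized ideal, that generates
    the maximal ideal of the localization. *)
Definition uniformizer t := p t /\ t != 0 /\
  forall y, p y -> exists2 w, w \in localization p & y = t * w.

(** Multiplication by [z] maps the maximal ideal of the localization into the
    localization and [t] to a unit, so [t] generates the maximal ideal. *)
Lemma uniformizer_intro t z : p t -> (forall y, p y -> z * y \in localization p) ->
  ~ localization_ideal p (z * t) -> uniformizer t.
Proof.
move=> pt zp nzt.
have zt0 : z * t != 0.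
  apply/eqP => zt0; apply: nzt; rewrite zt0; exact: (maxSpec0 (loc_max p)).
have [z0 t0] : z != 0 /\ t != 0 by apply/andP; rewrite -negb_or -mulf_eq0.
split=> //; split=> // y py; exists (z * y * (z * t)^-1).
  have [//|ztV] := localization_unit (zp _ pt).
  by apply: rpredM => //; exact: zp.
by field; rewrite z0 t0.
Qed.

(** If [1 = \sum_i u i * v i] with [u i] in [p] and [v i] in the inverse of [p],
    some [u i * v i] is outside [p]. *)
Lemma invertible_uniformizer : invertible_ideal A p -> exists t, uniformizer t.
Proof.
move=> [_ [J [_ pJ]]].
have mem_pJ u v : p u -> J v -> u * v \in A.
  move=> pu Jv; suff : [set` A] (u * v) by [].
  by rewrite -pJ; exists 1%N, (fun=> u), (fun=> v); rewrite big_ord1.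
have : [set` A] 1 by exact: rpred1.
rewrite -pJ => -[n [u [v [uv one]]]].
have [i npi] : exists i, ~ p (u i * v i).
  apply: contrapT => h; have [_ p1 _] := maxSpecP p; apply: p1; rewrite one.
  have [[sp _] _ _] := maxSpecP p; apply: (submod_sum _ sp) => i.
  by apply: contrapT => npi; apply: h; exists i.
have [pu Jv] := uv i; exists (u i); apply: (@uniformizer_intro _ (v i)) => //.
  by move=> y py; apply: sub_localization; rewrite mulrC; exact: mem_pJ.
rewrite mulrC => h; apply: npi; apply: localization_ideal_inv => //.
exact: mem_pJ.
Qed.

Hypothesis A_fin : finite_colength A.

(** The quotient of the localization by [t] is the residue field, a simple
    module. *)
Lemma ord_uniformizer t : uniformizer t -> ord p t = 1.
Proof.
move=> [pt [t0 tP]]; rewrite ord_int//; last exact: maxSpec_sub pt.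
congr Posz; apply: length_quotE.
suff -> : principal_ideal (localization p) t = loc_max p.
  exact/cover_length/maximal_cover.
apply/seteqP; split=> [_ [x xA <-]|_ [a [s [pa sA ps ->]]]].
  rewrite mulrC; apply: (maxSpecM (p := loc_max p)) => //.
  exact: sub_localization_ideal.
have [w wA ->] := tP a pa; exists (w * s^-1); last by rewrite mulrA.
by rewrite /= rpredM// localizationV.
Qed.

(** The case of the Chinese remainder theorem used in [approximation]; if [u] and
    [u'] work for two sets of ideals, then [1 - (1 - u) * (1 - u')] works for
    their union. *)
Lemma maxSpec_avoid (s : seq (maxSpec A)) : p \notin s ->
  exists u, p u /\ forall q, q \in s -> q (1 - u).
Proof.
elim: s => [_|q s IH]; first by exists 0; split=> //; exact: maxSpec0.
rewrite inE negb_or => /andP[pq /IH[u [pu us]]].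
have [a [aA pa qa]] := maxSpec_neq pq.
have [y yA qy] := maxSpec_inv aA qa.
have uA := maxSpec_sub pu.
have oneA : (1 : K) \in A by exact: rpred1.
exists (u + a * y * (1 - u)); split.
  apply: maxSpecD => //; rewrite mulrAC mulrC; apply: maxSpecM => //.
  by rewrite mulrC; apply: maxSpecM => //; exact: rpredB.
move=> q'; rewrite inE => /predU1P[->|q's].
  have -> : 1 - (u + a * y * (1 - u)) = - (1 - u) * (a * y - 1) by ring.
  by apply: maxSpecM => //; rewrite rpredN rpredB.
have -> : 1 - (u + a * y * (1 - u)) = (1 - a * y) * (1 - u) by ring.
by apply: maxSpecM; [rewrite rpredB// rpredM | exact: us].
Qed.

Hypothesis A_frac : fraction_field A.

(** Weak approximation. With [u] in [p] and congruent to [1] modulo each [q] in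
    [s], the element [t (1 - u ^ 2) + u ^ 2] is congruent to [t] modulo [p ^ 2]
    and to [1] modulo each [q]. *)
Lemma approximation t (s : seq (maxSpec A)) : uniformizer t -> p \notin s ->
  exists x, [/\ x != 0, ord p x = 1 & forall q, q \in s -> ord q x = 0].
Proof.
move=> tP ps; have [u [pu us]] := maxSpec_avoid ps.
have [pt [t0 t_gen]] := tP; have [w wA uE] := t_gen u pu.
have [tA uA] := (maxSpec_sub pt, maxSpec_sub pu).
have oneA : (1 : K) \in A by exact: rpred1.
pose v := 1 - u * (u - w).
have xE : t * (1 - u ^+ 2) + u ^+ 2 = t * v.
  by rewrite /v {2}expr2 {3}uE; ring.
have loc_u := sub_localization_ideal pu.
have uL : u \in localization p by exact: sub_localization.
have vA : v \in localization p.
  by apply: rpredB; [exact: rpred1 | apply: rpredM => //; exact: rpredB].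
have nv : ~ localization_ideal p v.
  move=> mv; have [_ m1 _] := maxSpecP (loc_max p); apply: m1 => /=.
  have -> : 1 = v + (u - w) * u by rewrite /v; ring.
  apply: (maxSpecD (p := loc_max p)) => //; apply: (maxSpecM (p := loc_max p)) => //.
  exact: rpredB.
have [a [b [aA bA pb vE]]] : exists a b, [/\ a \in A, b \in A, ~ p b & v = a / b].
  by move: vA => /asboolP.
have pa : ~ p a by move=> pa; apply: nv; exists a, b.
have [a0 b0] := (compl_neq0 pa, compl_neq0 pb).
have v0 : v != 0 by rewrite vE mulf_neq0 ?invr_eq0.
have ord_v : ord p v = 0.
  by rewrite vE (ordM A_fin A_frac) ?invr_eq0// (ordV A_fin A_frac)// !ord_eq0// oppr0.
exists (t * (1 - u ^+ 2) + u ^+ 2); split.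
- by rewrite xE mulf_neq0.
- by rewrite xE (ordM A_fin A_frac)// ord_v (ord_uniformizer tP) addr0.
move=> q qs; apply: (ord_eq0 A_fin).
  by rewrite rpredD ?rpredM ?rpredB ?rpredX.
move=> qx; have [_ q1 _] := maxSpecP q; apply: q1.
have -> : 1 = (t * (1 - u ^+ 2) + u ^+ 2) + (1 - t) * (1 + u) * (1 - u) by ring.
apply: maxSpecD => //; apply: maxSpecM; last exact: us.
by rewrite rpredM ?rpredB ?rpredD.
Qed.

End Uniformizer.

(** * The normalization *)

(** The determinant trick: [y] is an eigenvalue of the matrix of the [c i j], hence
    a root of its characteristic polynomial. *)
Lemma integral_of_stable (K : fieldType) (A : subringClosed K) n
    (e : 'I_n -> K) (c : 'I_n -> 'I_n -> K) y :
  (forall i j, c i j \in A) -> (forall i, y * e i = \sum_j c i j * e j) ->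
  (exists i, e i != 0) -> y \in normalization A.
Proof.
move=> cA ye [i0 ei0]; apply/asboolP.
pose C : 'M[subring A]_n := \matrix_(i, j) Subring (cA j i).
exists (char_poly C); first exact: char_poly_monic.
rewrite map_char_poly -eigenvalue_root_char.
apply/eigenvalueP; exists (\row_i e i).
  apply/rowP => i; rewrite !mxE ye; apply: eq_bigr => j _.
  by rewrite !mxE /= mulrC.
by apply/eqP => /rowP/(_ i0); rewrite !mxE; apply/eqP.
Qed.

Section Normalization.
Variables (K : fieldType) (O : subringClosed K).
Hypotheses (O_frac : fraction_field O) (O_noetherian : noetherian O).
Hypothesis (O_dim : krull_dim O 1).
Hypothesis O_norm_fg : finitely_generated O [set` normalization O].
Local Notation Ot := (normalization O).

Let O_fin : finite_colength O := dim1_finite_colength O_noetherian O_dim.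
Let sub_norm : {subset O <= Ot} := @sub_normalization K O.

Lemma norm_finite_colength : finite_colength Ot.
Proof. exact: (finite_colength_extension sub_norm O_frac O_fin O_norm_fg). Qed.

Lemma norm_frac : fraction_field Ot.
Proof.
move=> x; have [a [b [aA bA b0 ->]]] := O_frac x.
by exists a, b; split=> //; exact: sub_norm.
Qed.

(** Multiplying by a conductor turns [P] into an ideal of the noetherian ring
    [O]. *)
Lemma norm_maximal_fg (P : maxSpec Ot) : exists n (e : 'I_n -> K),
  (forall i, P (e i)) /\ (forall x, P x -> exists2 c : 'I_n -> K,
    (forall i, c i \in O) & x = \sum_i c i * e i).
Proof.
have [[sP PO] _ _] := maxSpecP P.
have [d [dO d0 dOt]] := conductor O_frac O_norm_fg.
have iP : ideal O (scale d P).
  split; first exact/submod_scale/(submod_restrict sub_norm).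
  by move=> _ [x Px <-]; exact/dOt/(maxSpec_sub Px).
have [n [e PE]] := O_noetherian iP; exists n, (fun i => d^-1 * e i); split.
  move=> i; have : scale d P (e i).
    rewrite PE; exists (fun j => (j == i)%:R).
      by move=> j; case: (j == i); rewrite ?rpred0 ?rpred1.
    by rewrite (bigD1 i)//= eqxx mul1r big1 ?addr0// => j /negbTE ->; rewrite mul0r.
  by move=> [x Px <-]; rewrite mulKf.
move=> x Px; have : scale d P (d * x) by exists x.
rewrite PE => -[c cO dxE]; exists c => //; rewrite -[x](mulKf d0) dxE mulr_sumr.
by apply: eq_bigr => i _; rewrite mulrCA.
Qed.

(** Take [a] in [P] and [b] spanning a simple submodule modulo [a] in the
    localization at [P]; then [z = b / a] maps [P] into the localization without
    lying in it. If [z] mapped [P] into its own localization, a multiple of [z] by a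
    denominator prime to [P] would stabilize the finitely generated [O]-module
    [P], hence be integral over [O]. *)
Lemma norm_uniformizer (P : maxSpec Ot) : exists t, uniformizer P t.
Proof.
have [a [Pa aO] a0] := maxSpec_neq0 O_dim (contraction P).
have h := loc_length_spec norm_finite_colength P (sub_norm aO) a0.
have ne : scale a [set` localization P] <> [set` localization P].
  move=> e; have : [set` localization P] 1 by exact: rpred1.
  rewrite -e => -[x xA ax1]; have [_ m1 _] := maxSpecP (loc_max P); apply: m1.
  rewrite -ax1 mulrC; apply: (maxSpecM (p := loc_max P)) => //.
  exact: sub_localization_ideal.
have [N' cN' N'sub] := has_length_first h ne.
have [Q QN'] := cover_annihilator cN'.
have [b N'b Nb] := cover_elt cN'; pose z := b / a.
have zP y : P y -> z * y \in localization P.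
  move=> Py; have [||w wA e] := QN' y b => //.
    by rewrite (loc_max_unique Q); exact: sub_localization_ideal.
  by suff -> : z * y = w by []; rewrite /z mulrAC [b * y]mulrC -e [a * w]mulrC mulfK.
have zNP : z \notin localization P.
  by apply/negP => zA; apply: Nb; exists z => //; rewrite /z mulrC mulfVK.
have [t Pt nzt] : exists2 t, P t & ~ localization_ideal P (z * t).
  apply: contrapT => noT.
  have zPm y : P y -> localization_ideal P (z * y).
    by move=> Py; apply: contrapT => nzy; apply: noT; exists y.
  have [n [e [Pe e_gen]]] := norm_maximal_fg P.
  (* s * z maps the generators of P into P. *)
  have [s [sA Ps sz]] := common_denominator (fun i => zP _ (Pe i)).
  have P_stable i : P (s * z * e i).
    apply: localization_ideal_inv; first by rewrite -mulrA.
    rewrite -mulrA; apply: (maxSpecM (p := loc_max P)); last exact: zPm.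
    exact: sub_localization.
  have [c cO ce] : exists2 c : 'I_n -> 'I_n -> K, (forall i j, c i j \in O) &
      forall i, s * z * e i = \sum_j c i j * e j.
    have /choice[c cP] : forall i, exists c : 'I_n -> K,
        (forall j, c j \in O) /\ s * z * e i = \sum_j c j * e j.
      by move=> i; have [c] := e_gen _ (P_stable i); exists c.
    by exists c => i; have [] := cP i.
  have szOt : s * z \in Ot.
    apply: (integral_of_stable cO ce).
    apply: contrapT => e0; have [d _ aE] := e_gen _ Pa.
    move/eqP: a0; apply; rewrite aE big1// => i _.
    have -> : e i = 0; last by rewrite mulr0.
    by apply/eqP; apply: contrapT => /negP ei; apply: e0; exists i.
  move/negP: zNP; apply; apply/asboolP; exists (s * z), s; split=> //.
  by field; exact: compl_neq0 Ps.
by exists t; exact: uniformizer_intro nzt.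
Qed.

Lemma degree_basis (P : maxSpec Ot) :
  exists e : 'I_(degree P) -> K, residue_basis O Ot P e.
Proof.
apply: (@xgetPex _ 0%N [set n | exists e : 'I_n -> K, residue_basis O Ot P e]).
apply: (residue_basis_exists sub_norm O_norm_fg) => c cO Pc.
exact: contraction_inv.
Qed.

Lemma contractionP (P : maxSpec Ot) a : a \in O -> contraction P a <-> P a.
Proof. by move=> aO; split=> [[]|]. Qed.

(** The lengths of [O_p / a O_p] and of [Ot_p / a Ot_p] agree, since [Ot_p / O_p]
    and [a Ot_p / a O_p] are isomorphic of finite length. The second length is
    read off a filtration of [Ot / a Ot]. *)
Lemma loc_length_pushforward (p : maxSpec O) a s : a \in O -> a != 0 ->
  factors (scale a [set` Ot]) [set` Ot] s ->
  loc_length p a = (\sum_(P <- s | contraction P == p) degree P)%N.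
Proof.
move=> aO a0 hs.
have h1 := loc_length_spec O_fin p aO a0.
have [c hc] : exists c, has_length (localization p) [set` localization p]
    (locmod p [set` Ot]) c.
  have [n] := finite_length_extension sub_norm O_frac O_fin O_norm_fg.
  move=> /has_length_factors[s' hs'].
  exists (\sum_(P <- s' | P == p) 1)%N; rewrite -locmod_ring.
  apply: (factors_localized (w := fun=> 1%N) _ hs') => //.
  - by move=> P /eqP ->.
  - by move=> P; exact: maxSpec_neq.
  - by move=> P _; exact: residue_basis_self.
have h2 : has_length (localization p) (scale a (locmod p [set` Ot]))
    (locmod p [set` Ot]) (\sum_(P <- s | contraction P == p) degree P)%N.
  rewrite -locmod_scale; apply: (factors_localized sub_norm hs).
  - by move=> P /eqP <- b bO; exact: contractionP.
  - by move=> P /maxSpec_neq[b [bO Pb pb]]; exists b; split=> //; exact/contractionP.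
  - by move=> P _; exact: degree_basis.
have := has_length_unique (has_length_trans h1 hc)
  (has_length_trans (has_length_scale a0 hc) h2).
by rewrite addnC => /addnI.
Qed.

End Normalization.

(** * Homomorphisms of quotient groups *)

Section QuotientMaps.

Lemma additive_of (U V : zmodType) (f : U -> V) :
  {morph f : x y / x - y} -> exists g : {additive U -> V}, forall x, g x = f x.
Proof.
move=> fB; pose m := GRing.isZmodMorphism.Build U V f fB.
by exists (HB.pack f m : {additive U -> V}).
Qed.

Lemma inj_surj_bijective (T U : Type) (f : T -> U) :
  injective f -> (forall y, exists x, f x = y) -> bijective f.
Proof.
move=> f_inj /choice[g gK]; exists g => // x.
by apply: f_inj; rewrite gK.
Qed.

Lemma isomorphic_sym (U V : zmodType) : isomorphic U V -> isomorphic V U.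
Proof.
move=> [f [g fK gK]].
have [h hE] : exists h : {additive V -> U}, forall x, h x = g x.
  by apply: additive_of => x y; rewrite -{1}[x]gK -{1}[y]gK -raddfB fK.
by exists h, f => x; rewrite hE.
Qed.

Variables (V W : zmodType) (S : set V).

Lemma quot_class_surj (q : quotient S) : exists x, quot_class S x = q.
Proof. by exists (repr q); exact: reprK. Qed.

Lemma quotient_lift (h : {additive V -> W}) : (forall x, S x -> h x = 0) ->
  exists f : {additive quotient S -> W}, forall x, f (quot_class S x) = h x.
Proof.
move=> hS; have gen0 x : generated S x -> h x = 0.
  move=> /(_ (fun x => h x == 0)) gx; apply/eqP; apply: gx.
    split=> [|y z]; rewrite !unfold_in ?raddf0// => /eqP hy /eqP hz.
    by rewrite raddfB hy hz subrr.
  by move=> y /hS hy; rewrite /= unfold_in hy.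
have classE x : h (repr (quot_class S x)) = h x.
  by apply/esym/subr0_eq; rewrite -raddfB; apply: gen0; exact: generated_repr.
have [f fE] : exists f : {additive quotient S -> W}, forall q, f q = h (repr q).
  apply: additive_of => q1 q2.
  have [[x1 <-] [x2 <-]] := (quot_class_surj q1, quot_class_surj q2).
  by rewrite -raddfB !classE raddfB.
by exists f => x; rewrite fE.
Qed.

Lemma quotient_iso (h : {additive V -> W}) :
  (forall y, exists x, h x = y) -> (forall x, h x = 0 <-> S x) ->
  isomorphic (quotient S) W.
Proof.
move=> h_surj hS; have [f fE] := quotient_lift (fun x => (hS x).2).
exists f; apply: inj_surj_bijective.
  move=> q1 q2; have [[x1 <-] [x2 <-]] := (quot_class_surj q1, quot_class_surj q2).
  rewrite !fE => /eqP; rewrite -subr_eq0 -raddfB => /eqP/hS Sx.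
  by apply/quot_piP => H cH SH; exact: SH.
by move=> y; have [x <-] := h_surj y; exists (quot_class S x).
Qed.

End QuotientMaps.

(** Bezout: the gcd of a family is an integral combination of its members. *)
Lemma int_subgroup_gcd (H : int -> Prop) (n : nat) (d : 'I_n -> nat) :
  H 0 -> (forall x y, H x -> H y -> H (x - y)) -> (forall i, H (d i)%:Z) ->
  forall m : int, H (m * (\big[gcdn/0%N]_(i < n) d i)%:Z).
Proof.
move=> H0 HB Hd.
have HN x : H x -> H (- x) by move=> Hx; rewrite -sub0r; exact: HB.
have HD x y : H x -> H y -> H (x + y).
  by move=> Hx /HN Hy; rewrite -[y]opprK; exact: HB.
have HMn x n' : H x -> H (x *+ n').
  by move=> Hx; elim: n' => [|n' IH]; rewrite ?mulr0n// mulrS; exact: HD.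
have HM m x : H x -> H (m * x).
  move=> Hx; case: m => n'; first by rewrite -natz mulr_natl; exact: HMn.
  by rewrite NegzE mulNr; apply: HN; rewrite -natz mulr_natl; exact: HMn.
move=> m; apply: (HM); apply: (big_ind (fun k : nat => H k%:Z)) => // x y Hx Hy.
case: (posnP x) => [->|x_gt0]; first by rewrite gcd0n.
have [u v uv _] := egcdnP y x_gt0.
have -> : (gcdn x y)%:Z = u%:Z * x%:Z - v%:Z * y%:Z.
  by rewrite -!PoszM uv PoszD addrC addKr.
by apply: HB; exact: HM.
Qed.

(** * The push-forward of divisors *)

Section PushforwardAdditive.
Variables (K : fieldType) (O : subringClosed K).
Local Notation Ot := (normalization O).

(** Summing over a set larger than the support lets divisors with different
    supports be added. *)
Lemma pushforward_big (D : Div Ot) (r : seq (maxSpec Ot)) :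
  uniq r -> {subset dom D <= r} ->
  pushforward D = \sum_(P <- r) << coeff P D * (degree P)%:Z *g contraction P >>.
Proof.
move=> r_uniq Dr; rewrite /pushforward.
rewrite (perm_big [seq P <- r | P \in dom D]) /=; last first.
  apply: uniq_perm; rewrite ?uniq_dom ?filter_uniq// => P.
  by rewrite mem_filter; case: (boolP (P \in dom D)) => // /Dr ->.
rewrite big_filter big_mkcond; apply: eq_bigr => P _.
by case: ifPn => // /coeff_outdom ->; rewrite mul0r freegU0.
Qed.

Lemma pushforward_is_additive : {morph @pushforward K O : D E / D - E}.
Proof.
move=> D E; pose r := undup (dom D ++ dom E).
rewrite !(@pushforward_big _ r) ?undup_uniq//.
- rewrite -sumrB; apply: eq_bigr => P _.
  by rewrite freegUB coeffB mulrBl.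
- by move=> P PE; rewrite mem_undup mem_cat PE orbT.
- by move=> P PD; rewrite mem_undup mem_cat PD.
- by move=> P /domB; rewrite mem_undup.
Qed.

HB.instance Definition _ :=
  GRing.isZmodMorphism.Build (Div Ot) (Div O) (@pushforward K O)
    pushforward_is_additive.

Lemma pushforwardU k (P : maxSpec Ot) :
  pushforward << k *g P >> = << k * (degree P)%:Z *g contraction P >>.
Proof.
rewrite (@pushforward_big _ [:: P])//; first by rewrite big_seq1 coeffU eqxx mulr1.
move=> Q; rewrite mem_dom coeffU inE; case: (eqVneq P Q) => // _.
by rewrite mulr0 eqxx.
Qed.

Lemma coeff_pushforward D (p : maxSpec O) : coeff p (pushforward D) =
  \sum_(P <- dom D | contraction P == p) coeff P D * (degree P)%:Z.
Proof.
rewrite raddf_sum [RHS]big_mkcond; apply: eq_bigr => P _.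
by rewrite /= coeffU; case: (contraction P == p); rewrite ?mulr1 ?mulr0.
Qed.

Hypotheses (O_frac : fraction_field O) (O_noetherian : noetherian O).
Hypothesis (O_dim : krull_dim O 1).
Hypothesis O_norm_fg : finitely_generated O [set` Ot].
Let Ofin : finite_colength O := dim1_finite_colength O_noetherian O_dim.
Let Otfin : finite_colength Ot := norm_finite_colength O_frac O_noetherian O_dim O_norm_fg.
Let Otfrac : fraction_field Ot := norm_frac O_frac.

(** For [x] in [O] one filtration computes both sides: over the normalization its
    factors count the orders, and over [O] they are weighted by their degrees. *)
Lemma pushforward_div x : x != 0 -> pushforward (div Ot x) = div O x.
Proof.
have int_case a : a \in O -> a != 0 -> pushforward (div Ot a) = div O a.
  move=> aO a0; have aOt : a \in Ot by exact: sub_normalization.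
  have [s hs] := finite_colength_factors Otfin aOt a0.
  rewrite (div_factors Otfin aOt a0 hs) raddf_sum; apply/esym/div_eq => p.
  rewrite (ord_int Ofin)// (loc_length_pushforward O_frac _ _ _ _ _ _ hs)//.
  rewrite raddf_sum -[RHS](natz) natr_sum [RHS]big_mkcond.
  apply: eq_bigr => P _; rewrite /= pushforwardU coeffU mul1r.
  by case: (contraction P == p); rewrite ?mulr1 ?mulr0 ?natz.
move=> /(fracP O_frac)[a [b [[aO bO] a0 b0 ->]]].
rewrite (div_frac Otfin) ?sub_normalization// (div_frac Ofin)//.
by rewrite raddfB /= !int_case.
Qed.

End PushforwardAdditive.

(** * Chow groups of local rings *)

Section LocalChow.
Variables (K : fieldType) (A : subringClosed K) (p : maxSpec A).
Hypotheses (A_frac : fraction_field A) (A_fin : finite_colength A).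
Let Ap_frac := localization_frac p A_frac.
Let Ap_fin := localization_finite_colength (p := p) A_fin.

(** A local ring has a single maximal ideal, so its divisors are integers. *)
Lemma local_divE (D : Div (localization p)) : D = << coeff (loc_max p) D *g loc_max p >>.
Proof.
apply/eqP/freeg_eqP => q; rewrite (loc_max_unique q) coeffU eqxx mulr1//.
Qed.

Lemma local_principal (D : Div (localization p)) :
  principal_divisors D <-> exists2 x, x != 0 & coeff (loc_max p) D = ord p x.
Proof.
split=> [[x x0 ->]|[x x0 De]].
  by exists x => //; rewrite (coeff_div Ap_fin Ap_frac)// ord_loc_max.
exists x => //; apply/esym/div_eq => q.
by rewrite (loc_max_unique q) De ord_loc_max.
Qed.

Lemma local_class_eq0 (D : Div (localization p)) :
  divisor_class (localization p) D = 0 <->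
  exists2 x, x != 0 & coeff (loc_max p) D = ord p x.
Proof. by rewrite (divisor_class_eq0 Ap_fin Ap_frac); exact: local_principal. Qed.

Lemma ord_image_trivial t : uniformizer p t -> forall k : int,
  exists2 x, x != 0 & k = ord p x.
Proof.
move=> tP; have [_ [t0 _]] := tP; have ordX n : ord p (t ^+ n) = n%:Z.
  elim: n => [|n IH].
    by rewrite expr0 ord_eq0 ?rpred1//; exact: compl1.
  rewrite exprS (ordM A_fin A_frac)// ?expf_neq0// IH (ord_uniformizer A_fin tP).
  by rewrite -PoszD add1n.
case=> n; first by exists (t ^+ n); rewrite ?expf_neq0 ?ordX.
exists (t ^+ n.+1)^-1; first by rewrite invr_eq0 expf_neq0.
by rewrite (ordV A_fin A_frac) ?expf_neq0// ordX NegzE.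
Qed.

Lemma local_chow_uniformizer t : uniformizer p t ->
  forall c : Chow (localization p), c = 0.
Proof.
move=> tP c; have [D <-] := quot_class_surj c.
by apply/local_class_eq0; exact: ord_image_trivial tP _.
Qed.

Lemma local_chow_cyclic (g : nat) :
  (forall k : int, (exists2 x, x != 0 & k = ord p x) <-> exists m : int, k = m * g%:Z) ->
  isomorphic (Chow (localization p)) (Zmod g).
Proof.
move=> gP; pose S := [set k : int | exists m : int, k = m * g%:Z].
have S_closed : zmod_closed (fun k => `[< S k >]).
  split; first by apply/asboolP; exists 0; rewrite mul0r.
  move=> _ _ /asboolP[m ->] /asboolP[n ->]; apply/asboolP; exists (m - n).
  by rewrite mulrBl.
have [h hE] : exists h : {additive Div (localization p) -> Zmod g},
    forall D, h D = quot_class S (coeff (loc_max p) D).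
  by apply: additive_of => D E; rewrite !raddfB.
apply: (quotient_iso (h := h)).
  move=> q; have [k <-] := quot_class_surj q; exists << k *g loc_max p >>.
  by rewrite hE coeffU eqxx mulr1.
move=> D; rewrite hE; apply: (iff_trans (quot_class_eq0 S_closed _)).
by apply: (iff_trans (iff_sym (gP _))); apply: iff_sym; exact: local_principal.
Qed.

End LocalChow.

(** * The group of orders at a maximal ideal *)

Section OrderImage.
Variables (K : fieldType) (O : subringClosed K).
Hypotheses (O_frac : fraction_field O) (O_noetherian : noetherian O).
Hypothesis (O_dim : krull_dim O 1).
Local Notation Ot := (normalization O).
Hypothesis O_norm_fg : finitely_generated O [set` Ot].
Let Ofin : finite_colength O := dim1_finite_colength O_noetherian O_dim.
Let Otfin : finite_colength Ot := norm_finite_colength O_frac O_noetherian O_dim O_norm_fg.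
Let Otfrac : fraction_field Ot := norm_frac O_frac.

Lemma ord_pushforward (p : maxSpec O) x : x != 0 ->
  ord p x = coeff p (pushforward (div Ot x)).
Proof. by move=> x0; rewrite pushforward_div// (coeff_div Ofin O_frac). Qed.

Section Fiber.
Variables (p : maxSpec O) (n : nat) (P : 'I_n -> maxSpec Ot).
Hypothesis P_over : forall Q, contraction Q = p <-> exists j, P j = Q.
Let g := \big[gcdn/0%N]_(j < n) degree (P j).

Lemma coeff_pushforward_gcd (D : Div Ot) :
  exists m : int, coeff p (pushforward D) = m * g%:Z.
Proof.
rewrite coeff_pushforward.
apply: (big_ind (fun k => exists m : int, k = m * g%:Z)).
- by exists 0; rewrite mul0r.
- by move=> _ _ [m ->] [m' ->]; exists (m + m'); rewrite mulrDl.
- move=> Q /eqP/P_over[j <-].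
  have /dvdnP[k ->] : (g %| degree (P j))%N by exact: biggcdn_inf.
  by exists (coeff (P j) D * k%:Z); rewrite PoszM mulrA.
Qed.

Lemma ord_image_gcd (k : int) :
  (exists2 x, x != 0 & k = ord p x) <-> exists m : int, k = m * g%:Z.
Proof.
split=> [[x x0 ->]|[m ->]].
  by rewrite ord_pushforward//; exact: coeff_pushforward_gcd.
apply: (int_subgroup_gcd (H := fun k => exists2 x, x != 0 & k = ord p x)).
- exists 1; rewrite ?oner_neq0// ord_eq0 ?rpred1//; exact: compl1.
- move=> _ _ [x x0 ->] [y y0 ->]; exists (x / y).
    by rewrite mulf_neq0 ?invr_eq0.
  by rewrite (ordM Ofin O_frac) ?invr_eq0// (ordV Ofin O_frac).
move=> j; have [t tP] := norm_uniformizer O_frac O_noetherian O_dim O_norm_fg (P j).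
pose s := [seq P i | i <- enum 'I_n & P i != P j].
have Pjs : P j \notin s.
  by apply/mapP => -[i]; rewrite mem_filter => /andP[/eqP + _] e; apply; rewrite e.
(* By the push-forward formula, such an x has order degree (P j) at p. *)
have [x [x0 ordj ords]] := approximation Otfin Otfrac tP Pjs.
exists x => //; rewrite ord_pushforward// coeff_pushforward big_mkcond.
rewrite (bigD1_seq (P j)) ?uniq_dom//=; last first.
  by rewrite mem_dom (coeff_div Otfin Otfrac)// ordj.
have -> : contraction (P j) = p by apply/P_over; exists j.
rewrite eqxx (coeff_div Otfin Otfrac)// ordj mul1r big1 ?addr0// => Q QPj.
case: eqP => // /P_over[i iQ]; rewrite (coeff_div Otfin Otfrac)// ords ?mul0r//.
by apply/mapP; exists i; rewrite ?iQ// mem_filter iQ QPj mem_enum.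
Qed.

End Fiber.

(** If the coefficient of [D] at [p] is the order of [x], the part of [div x] over
    [p] pushes forward to the part of [D] at [p]. *)
Lemma pushforward_of_locally_principal (D : Div O) :
  (forall p : maxSpec O, exists2 x, x != 0 & coeff p D = ord p x) ->
  exists E : Div Ot, pushforward E = D.
Proof.
move=> D_loc.
have /choice[x xP] : forall p : maxSpec O, exists x, x != 0 /\ coeff p D = ord p x.
  by move=> p; have [x] := D_loc p; exists x.
(* The part over p of the divisor of x p on the normalization. *)
exists (\sum_(p <- dom D) \sum_(P <- dom (div Ot (x p)) | contraction P == p)
  << coeff P (div Ot (x p)) *g P >>).
rewrite raddf_sum -[RHS]freeg_sumE; apply: eq_bigr => p _.
have [x0 ->] := xP p.
rewrite raddf_sum ord_pushforward// coeff_pushforward.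
elim: (dom _) => [|P s IH]; first by rewrite !big_nil freegU0.
rewrite !big_cons; case: eqP => // cP.
by rewrite -freegUD -IH /= pushforwardU cP.
Qed.

End OrderImage.

(** * Direct sums and images *)

Section DirectSums.

Lemma dsum_iso (r : nat) (V W : 'I_r -> zmodType) :
  (forall i, isomorphic (V i) (W i)) -> isomorphic (dsum V) (dsum W).
Proof.
move=> VW.
have [f fP] : exists f : forall i, {additive V i -> W i}, forall i, bijective (f i).
  by exists (fun i => sval (cid (VW i))) => i; exact: (svalP (cid (VW i))).
have fin (x : dsum V) : finite_set [set i | f i (x i) <> 0] by exact: finite_finset.
have [F FE] : exists F : {additive dsum V -> dsum W}, forall x, F x = DSum (fin x).
  by apply: additive_of => x y; apply: dsum_ext => i /=; rewrite raddfB.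
exists F; apply: inj_surj_bijective.
  move=> x y; rewrite !FE => e; apply: dsum_ext => i.
  by apply: (bij_inj (fP i)); exact: (congr1 (fun z : dsum W => z i) e).
move=> y.
have [x xP] : exists x : forall i, V i, forall i, f i (x i) = y i.
  have surj i : exists x, f i x = y i by have [h _ hK] := fP i; exists (h (y i)).
  by exists (fun i => sval (cid (surj i))) => i; exact: (svalP (cid (surj i))).
have x_fin : finite_set [set i | x i <> 0] by exact: finite_finset.
by exists (DSum x_fin); rewrite FE; apply: dsum_ext => i; exact: xP.
Qed.

Lemma img_iso (U V : zmodType) (f : {additive U -> V}) :
  isomorphic (img f) (quotient (ker f)).
Proof.
apply: isomorphic_sym.
have img_f x : f x \in img_pred f by apply/asboolP; exists x.
have [h hE] : exists h : {additive U -> img f}, forall x, h x = Img (img_f x).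
  by apply: additive_of => x y; apply: val_inj; rewrite /= raddfB.
apply: (quotient_iso (h := h)).
  move=> [y yP]; have /asboolP[x xy] := yP; exists x.
  by apply: val_inj; rewrite hE.
move=> x; rewrite hE; split=> [/(congr1 val) //|fx0].
by apply: val_inj.
Qed.

End DirectSums.

(** * The localization map *)

Section LocalizationMap.
Variables (K : fieldType) (O : subringClosed K).
Hypotheses (O_frac : fraction_field O) (Ofin : finite_colength O).

Lemma localize_divisorB (D E : Div O) (p : maxSpec O) :
  localize_divisor (D - E) p = localize_divisor D p - localize_divisor E p.
Proof. by rewrite /localize_divisor coeffB -freegUB raddfB. Qed.

Lemma localize_divisor_finite (D : Div O) :
  finite_set [set p | localize_divisor D p <> 0].
Proof.
apply: (sub_finite_set (B := [set` dom D])); last exact: finite_seq.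
move=> p /=; apply: contra_notT; rewrite mem_dom negbK => /eqP.
by rewrite /localize_divisor => ->; rewrite freegU0 raddf0.
Qed.

(** Membership in the kernel of localization is a condition on each coefficient
    separately. *)
Lemma localize_divisor_eq0 (D : Div O) (p : maxSpec O) :
  localize_divisor D p = 0 <-> exists2 x, x != 0 & coeff p D = ord p x.
Proof.
by rewrite (local_class_eq0 O_frac Ofin) coeffU eqxx mulr1.
Qed.

Lemma localization_map_exists :
  exists loc : {additive Chow O -> dsum (local_chow O)}, induced_by_localization loc.
Proof.
have [h hE] : exists h : {additive Div O -> dsum (local_chow O)},
    forall D, h D = DSum (localize_divisor_finite D).
  by apply: additive_of => D E; apply: dsum_ext => p; exact: localize_divisorB.
have [|loc locE] := quotient_lift (S := principal_divisors (A := O)) (h := h).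
  move=> _ [x x0 ->]; rewrite hE; apply: dsum_ext => p /=.
  by apply/localize_divisor_eq0; exists x => //; rewrite (coeff_div Ofin O_frac).
by exists loc => D p; rewrite [loc _]locE hE.
Qed.

Lemma local_class_repr (p : maxSpec O) (c : local_chow O p) :
  exists k : int, c = divisor_class (localization p) << k *g loc_max p >>.
Proof.
have [D <-] := quot_class_surj c; exists (coeff (loc_max p) D).
by rewrite -local_divE.
Qed.

Lemma localization_map_surj (loc : {additive Chow O -> dsum (local_chow O)}) :
  induced_by_localization loc -> forall z, exists y, loc y = z.
Proof.
move=> locE z.
have /choice[k kP] : forall p, exists k : int,
    z p = divisor_class (localization p) << k *g loc_max p >>.
  by move=> p; exact: local_class_repr.
have [s0 s0E] := (finite_seqP _).1 (dsum_finite z); pose s := undup s0.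
have mem_s q : q \in s <-> z q <> 0.
  by rewrite mem_undup; have <- : [set p | z p <> 0] q = (q \in s0) :> Prop by rewrite s0E.
exists (divisor_class O (\sum_(q <- s) << k q *g q >>)).
apply: dsum_ext => p; rewrite locE /localize_divisor raddf_sum.
case: (pselect (z p = 0)) => zp.
  rewrite big1_seq ?freegU0 ?raddf0// => q /= /mem_s zq.
  by rewrite coeffU; case: eqP => [e|]; rewrite ?mulr0//; rewrite e in zq.
rewrite (bigD1_seq p) ?undup_uniq//=; last exact/mem_s.
rewrite coeffU eqxx mulr1 big1 ?addr0 -?kP// => q /negbTE qp.
by rewrite coeffU qp mulr0.
Qed.

End LocalizationMap.

(** * The Chow group as an extension *)

Theorem theorem2p6 (K : fieldType) (O : subringClosed K)
    (O_frac : fraction_field O)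
    (O_noetherian : noetherian O)
    (O_dim : krull_dim O 1)
    (O_norm_fg : finitely_generated O [set` normalization O])
    (r : nat) (p : 'I_r -> maxSpec O)
    (p_inj : injective p)
    (p_noninv : forall q : maxSpec O,
       ~ invertible_ideal O q <-> exists i, p i = q)
    (r_ : 'I_r -> nat)
    (P : forall i : 'I_r, 'I_(r_ i) -> maxSpec (normalization O))
    (P_inj : forall i, injective (P i))
    (P_over : forall i (Q : maxSpec (normalization O)),
       contraction Q = p i <-> exists j, P i j = Q)
    (g : 'I_r -> nat)
    (gE : forall i, g i = \big[gcdn/0%N]_(j < r_ i) degree (P i j)) :
  exists (f : {additive Chow (normalization O) -> Chow O})
         (loc : {additive Chow O -> dsum (local_chow O)}),
  [/\ induced_by_pushforward f,
      induced_by_localization loc,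
      (forall q : maxSpec O, invertible_ideal O q ->
         forall c : Chow (localization q), c = 0),
      (forall i, isomorphic (Chow (localization (p i))) (Zmod (g i))) &
      short_exact (img_incl f) loc] /\
  [/\ isomorphic (img f) (quotient (ker f)),
      bijective (dsum_proj p : dsum (local_chow O) -> _),
      short_exact (img_incl f) (dsum_proj p \o loc) &
      isomorphic (dsum (fun i => local_chow O (p i))) (dsum (fun i => Zmod (g i)))].
Proof.
have Ofin : finite_colength O := dim1_finite_colength O_noetherian O_dim.
have ord_inv (q : maxSpec O) : invertible_ideal O q ->
    forall k : int, exists2 x, x != 0 & k = ord q x.
  by move=> /invertible_uniformizer[t tP]; exact: ord_image_trivial tP.
have ord_noninv i (k : int) :
    (exists2 x, x != 0 & k = ord (p i) x) <-> exists m : int, k = m * (g i)%:Z.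
  by rewrite gE; exact: ord_image_gcd.
have dichotomy (q : maxSpec O) : invertible_ideal O q \/ exists i, p i = q.
  by case: (pselect (invertible_ideal O q)) => [|/p_noninv]; [left|right].
have chow_inv (q : maxSpec O) : invertible_ideal O q ->
    forall c : Chow (localization q), c = 0.
  by move=> /invertible_uniformizer[t tP]; exact: local_chow_uniformizer tP.
have chow_noninv i : isomorphic (Chow (localization (p i))) (Zmod (g i)).
  exact: local_chow_cyclic.
have [h hE] : exists h : {additive Div (normalization O) -> Chow O},
    forall D, h D = divisor_class O (pushforward D).
  by apply: additive_of => D E; rewrite !raddfB.
have [|f fE] := quotient_lift (S := principal_divisors (A := normalization O)) (h := h).
  move=> _ [x x0 ->]; rewrite hE pushforward_div//.
  by apply/(divisor_class_eq0 Ofin O_frac); exists x.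
have f_ind : induced_by_pushforward f by move=> D; rewrite [LHS]fE hE.
have [loc loc_ind] := localization_map_exists O_frac Ofin.
have loc_surj := localization_map_surj loc_ind.
have loc_ker y : loc y = 0 <-> exists x, img_incl f x = y.
  have [D <-] := quot_class_surj y; split=> [loc0|[[v vP] e]].
    have [E DE] : exists E, pushforward E = D.
      apply: pushforward_of_locally_principal => // q.
      apply/(localize_divisor_eq0 O_frac Ofin); rewrite -loc_ind.
      exact: (congr1 (fun z : dsum (local_chow O) => z q) loc0).
    have fy : quot_class _ D \in img_pred f.
      by apply/asboolP; exists (divisor_class _ E); rewrite f_ind DE.
    by exists (Img fy).
  have /asboolP[c fc] := vP; have [E EC] := quot_class_surj c.
  have -> : quot_class (principal_divisors (A := O)) D = divisor_class O (pushforward E).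
    by rewrite -f_ind [divisor_class _ E]EC fc; exact: esym e.
  apply: dsum_ext => q; rewrite loc_ind; apply/(localize_divisor_eq0 O_frac Ofin).
  have [qinv|[i <-]] := dichotomy q; first exact: ord_inv.
  by apply/ord_noninv; rewrite gE; exact: coeff_pushforward_gcd.
have incl_inj : injective (img_incl f) by exact: val_inj.
(* An element of the direct sum is determined by its components at the p i since
   the local groups at the invertible ideals vanish. *)
have proj_inj : injective (dsum_proj p : dsum (local_chow O) -> _).
  move=> x y e; apply: dsum_ext => q.
  have [qinv|[i <-]] := dichotomy q; first by rewrite [LHS]chow_inv// [RHS]chow_inv.
  exact: (congr1 (fun z : dsum (fun i => local_chow O (p i)) => z i) e).
have proj_loc_surj z : exists y, (dsum_proj p \o loc) y = z.
  have /choice[k kP] : forall i, exists k : int,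
      z i = divisor_class (localization (p i)) << k *g loc_max (p i) >>.
    by move=> i; exact: local_class_repr.
  exists (divisor_class O (\sum_i << k i *g p i >>)); apply: dsum_ext => j /=.
  rewrite loc_ind kP /localize_divisor raddf_sum (bigD1 j)//= coeffU eqxx mulr1.
  rewrite big1 ?addr0// => i /negbTE ij.
  by rewrite coeffU (inj_eq p_inj) ij mulr0.
exists f, loc; split; split=> //.
- exact: img_iso.
- apply: inj_surj_bijective => // z; have [y <-] := proj_loc_surj z.
  by exists (loc y).
- split=> // y; rewrite -loc_ker; split=> /= [e|->]; last exact: raddf0.
  by apply: proj_inj; rewrite e raddf0.
- exact: dsum_iso.
Qed.
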